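(* Suppose $u_0\in X$. Then there exist $T=T(\|u_0\|_{C_b^1})>0$ and a unique function $u\in C([0,T];X)$ satisfying the integral equation $$u(\cdot,t)=E(t)u_0(\cdot)-\frac12\int_0^tE(t-s)\,\partial_x u^2(\cdot,s)\,ds,\qquad t\in[0,T].$$
   Context: $C_b(\mathbb{R})$ is the space of bounded continuous real-valued functions on $\mathbb{R}$ with norm $\|\cdot\|_{L^\infty}$; $C_b^1(\mathbb{R})$ is the space of $f\in C^1(\mathbb{R})$ with $f,f'\in C_b(\mathbb{R})$, with norm $\|f\|_{C_b^1}=\|f\|_{L^\infty}+\|f'\|_{L^\infty}$. $X=\{f\in C_b^1(\mathbb{R}) : f'\text{ is uniformly continuous}\}$, a Banach space with the norm $\|\cdot\|_{C_b^1}$. The notation $T=T(\|u_0\|_{C_b^1})$ means that $T$ depends on $u_0$ through $\|u_0\|_{C_b^1}$. Here $\partial_x u^2$ means $\partial_x(u^2)$. Fourier convention: $\hat f(\xi)=\frac{1}{\sqrt{2\pi}}\int e^{-i\xi x}f(x)\,dx$. Let $a=\frac12\Gamma(\frac23)$, $b=-\frac{\sqrt3}{2}\Gamma(\frac23)$, where $\Gamma$ is the gamma function. For $t>0$, the kernel $K(\cdot,t)$ is the inverse Fourier transform of $$\hat K(\xi,t)=e^{-t[\xi^2-\xi^{4/3}(a+ib\,\mathrm{sgn}(\xi))]},\qquad \xi^{4/3}=|\xi|^{4/3},$$ i.e. $K(x,t)=\frac{1}{\sqrt{2\pi}}\int e^{ix\xi}\hat K(\xi,t)\,d\xi$. For $\phi\in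 C_b(\mathbb{R})$ define $E(t)\phi(x)=\frac{1}{\sqrt{2\pi}}\big(K(\cdot,t)*\phi\big)(x)$ for $t>0$, $x\in\mathbb{R}$, and $E(0)\phi=\phi$. *)

(* Defs.v *)
From HB Require Import structures.
From mathcomp Require Import all_boot all_order all_algebra.
From mathcomp Require Import all_classical all_reals all_analysis.
From mathcomp Require Import measurable_realfun complex ring lra.

Set Implicit Arguments.
Unset Strict Implicit.
Unset Printing Implicit Defensive.

Import Order.TTheory GRing.Theory Num.Theory.
Import numFieldNormedType.Exports.

Local Open Scope classical_set_scope.
Local Open Scope ring_scope.
Local Open Scope complex_scope.

Section function_spaces.
Context {R : realType}.
Implicit Type f : R -> R.

Definition linfty_norm f : R := fine ('N[lebesgue_measure]_+oo[EFin \o f])%E.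

Definition Cb f : Prop := continuous f /\ bounded_fun f.

Definition Cb1 f : Prop :=
  [/\ (forall x, derivable f x 1), Cb f & Cb (derive1 f)].

Definition Cb1_norm f : R := linfty_norm f + linfty_norm (derive1 f).

Definition spaceX f : Prop := Cb1 f /\ unif_continuous (derive1 f).

(* Membership in C([0, T]; X): [u t] is the function u(., t), and continuity
   is with respect to the norm of X. *)
Definition continuous_in_X (T : R) (u : R -> R -> R) : Prop :=
  (forall t, t \in `[0, T] -> spaceX (u t)) /\
  (forall t, t \in `[0, T] ->
     Cb1_norm (u s \- u t) @[s --> within [set` `[0, T]] (nbhs t)] --> 0).

End function_spaces.

Section kernel.
Context {R : realType}.
Local Notation mu := (@lebesgue_measure R).

Definition Gamma (s : R) : R :=
  \int[mu]_(x in `]0, +oo[) (x `^ (s - 1) * expR (- x)).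

Definition cexp (z : R[i]) : R[i] :=
  (expR (complex.Re z))%:C *
  (cos (complex.Im z) +i* sin (complex.Im z)).

Definition cintegral (f : R -> R[i]) : R[i] :=
  (\int[mu]_x complex.Re (f x)) +i* (\int[mu]_x complex.Im (f x)).

Definition inv_fourier (g : R -> R[i]) (x : R) : R[i] :=
  (Num.sqrt (2 * pi))^-1%:C * cintegral (fun xi => cexp ('i * (x * xi)%:C) * g xi).

Definition coef_a : R := 2^-1 * Gamma (2 / 3).
Definition coef_b : R := - (Num.sqrt 3 / 2) * Gamma (2 / 3).

Definition K_hat (t xi : R) : R[i] :=
  cexp (- t%:C * ((xi ^+ 2)%:C
    - (`|xi| `^ (4 / 3))%:C * (coef_a%:C + 'i * coef_b%:C * (Num.sg xi)%:C))).

Definition K_complex (x t : R) : R[i] := inv_fourier (K_hat t) x.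

Definition kernelK (x t : R) : R := complex.Re (K_complex x t).

Lemma Rintegral_odd (f : R -> R) : measurable_fun setT f ->
  (forall x, f (- x) = - f x) -> \int[mu]_x f x = 0.
Proof.
move=> mf fodd; rewrite /Rintegral integralE.
have -> : (\int[mu]_x (EFin \o f)^\- x = \int[mu]_x (EFin \o f)^\+ x)%E.
  have mfn : measurable_fun setT (EFin \o f)^\-%E.
    by apply: measurable_funeneg; exact/measurable_EFinP.
  transitivity (\int[mu]_x ((EFin \o f)^\- (- x)%R))%E; last first.
    by apply: eq_integral => y _; rewrite funeposE funenegE /= fodd opprK.
  rewrite -[in RHS](preimage_setT (-%R : _ -> measurableTypeR R)).
  rewrite -ge0_integral_pushforward//=.
  by apply: eq_measure_integral => //= A mA AS; exact/esym/lebesgue_measureN.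
set I := integral _ _ _.
by case: I => [r||] //=; rewrite ?subrr.
Qed.

Lemma Im_integrand (x t xi : R) :
  complex.Im (cexp ('i * (x * xi)%:C) * K_hat t xi) =
  expR (- t * (xi ^+ 2 - `|xi| `^ (4 / 3) * coef_a)) *
  sin (x * xi + t * `|xi| `^ (4 / 3) * coef_b * Num.sg xi).
Proof.
rewrite /K_hat /cexp /= !(mul0r, mulr0, mul1r, subr0, sub0r, oppr0, addr0, add0r).
rewrite expR0 sinD !(mul0r, mulr0, mul1r, addr0, subr0) mulrNN !mulrA; ring.
Qed.

Lemma measurable_sgr : measurable_fun setT (@Num.sg R).
Proof.
apply: nondecreasing_measurable => // x y xy.
by case: (sgrP x) xy => x0 xy; case: (sgrP y) xy => //= y0 xy; lra.
Qed.

(* The kernel is real valued, so that [kernelK] loses no information. *)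
Lemma K_complexE (x t : R) : K_complex x t = (kernelK x t)%:C.
Proof.
rewrite /kernelK /K_complex /inv_fourier.
rewrite [cintegral _](_ : _ = (complex.Re (cintegral
    (fun xi => cexp ('i * (x * xi)%:C) * K_hat t xi)))%:C).
  by simpc.
congr (_ +i* _); rewrite Rintegral_odd//.
- under eq_fun do rewrite Im_integrand.
  have mp : measurable_fun setT (fun xi : R => `|xi| `^ (4 / 3)).
    by apply: (measurableT_comp (measurable_powR _)).
  apply: measurable_funM.
    apply: measurableT_comp => //; apply: measurable_funM => //.
    apply: measurable_funB => //; exact: measurable_funM.
  apply: (measurableT_comp (continuous_measurable_fun (@continuous_sin R))).
  apply: measurable_funD; first exact: measurable_funM.
  apply: measurable_funM; last exact: measurable_sgr.
  apply: measurable_funM => //; exact: measurable_funM.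
- move=> xi; rewrite !Im_integrand sqrrN normrN sgrN !mulrN -opprD sinN mulrN.
  by [].
Qed.

Definition convolution (f g : R -> R) (x : R) : R :=
  \int[mu]_y (f (x - y) * g y).

Definition semigroupE (t : R) (phi : R -> R) (x : R) : R :=
  if 0 < t then (Num.sqrt (2 * pi))^-1 * convolution (kernelK ^~ t) phi x
  else phi x.

(* The integral in s is taken pointwise in x.  For u in C([0, T]; X) its
   integrand is bounded and measurable in s. *)
Definition integral_equation (T : R) (u0 : R -> R) (u : R -> R -> R) : Prop :=
  forall t, t \in `[0, T] -> forall x,
    u t x = semigroupE t u0 x
      - 2^-1 * \int[mu]_(s in `[0, t])
                 semigroupE (t - s) (derive1 (fun y => u s y ^+ 2)) x.

End kernel.

(* Main.v *)
(* Substituting t = tau^6 and xi = (zeta / tau)^3 removes every fractional power: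
   up to rescaling by tau^3, the kernel at time tau^6 is the oscillatory integral
     int_0^oo zeta^2 exp(- zeta^6 + tau^2 a zeta^4) cos(z zeta^3 + tau^2 b zeta^4) dzeta.
   Two integrations by parts show that it and its z-derivatives decay like
   1 / (1 + z^2), uniformly for tau <= 1; at tau = 0 it is a Gaussian, whose mass
   gives the strong continuity of E(t) at t = 0. In particular d_x E(t) has norm
   O(tau^-3) = O(t^(-1/2)), which is integrable in time.
   The unknown is reduced to g = u u_x: u solves the integral equation iff g is a
   fixed point of
     g |-> (E(t) u0 - int_0^t E(t - s) g ds) (E(t) u0' - int_0^t d_x E(t - s) g ds),
   a map on bounded uniformly continuous functions of (t, x). For T small it
   preserves a ball, and on any ball it is a contraction for the norm weighted by
   exp(- m^3 t) with m large; this gives existence, and uniqueness among all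
   solutions, since by Heine-Cantor in time every u in C([0, T]; X) yields a
   bounded uniformly continuous u u_x. *)

Require Import Defs.
From mathcomp Require Import all_boot all_order all_algebra.
From mathcomp Require Import all_classical all_reals all_analysis.
From mathcomp Require Import measurable_realfun ess_sup_inf complex ring lra zify.

Set Implicit Arguments.
Unset Strict Implicit.
Unset Printing Implicit Defensive.

Import Order.TTheory GRing.Theory Num.Theory.
Import numFieldNormedType.Exports.

Local Open Scope classical_set_scope.
Local Open Scope ring_scope.

(** * Integration on the line *)

Section integrals.
Context {R : realType}.
Local Notation mu := (@lebesgue_measure R).
Local Notation RR := (measurableTypeR R).
Implicit Types (f g F G H : R -> R) (D : set RR).

(** The obstacle is that [|xi| ^ (4/3)] is not smooth at 0, so the kernel has only polynomial decay.
    On the half-line of the cubic variable this singularity shows up as a boundary term at 0, and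
    that term vanishes for the phases that occur; this is what permits the second integration by
    parts.

    The sixth root of time also tames the time integral: with [s = t - tau^6] the Jacobian [6 tau^5]
    absorbs the [tau^-3] of [d_x E], so the Duhamel integral and its [x]-derivative both have
    integrands continuous up to [tau = 0].

    Iterating on [g = u u_x] keeps every estimate in the sup norm: [u] and [u_x] are read off from
    [g] by explicit formulas, so no limit is ever taken in X. The datum is differentiated directly,
    while for the source the derivative falls on the kernel.

    A small [T] is needed only to keep a ball invariant. Another solution may live in a much larger
    ball on the same interval, so the contraction cannot come from small [T]; the time weight
    provides it for any radius. *)

Lemma integrable_dominated D f g : measurable D -> measurable_fun D f ->
  mu.-integrable D (EFin \o g) -> (forall z, D z -> `|f z| <= g z) ->
  mu.-integrable D (EFin \o f).
Proof.
move=> mD mf ig fg; apply: (le_integrable mD _ _ ig).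
  exact/measurable_EFinP.
move=> z Dz /=; rewrite lee_fin (le_trans (fg z Dz))//.
by rewrite ler_norm.
Qed.

Lemma normr_Rintegral_dominated D f g : measurable D -> measurable_fun D f ->
  mu.-integrable D (EFin \o g) -> (forall z, D z -> `|f z| <= g z) ->
  `|\int[mu]_(z in D) f z| <= \int[mu]_(z in D) g z.
Proof.
move=> mD mf ig fg.
have if_ := integrable_dominated mD mf ig fg.
have h := (le_normr_Rintegral mD if_).
apply: (le_trans h).
apply: le_Rintegral => //.
exact: integrable_norm if_.
Qed.

(** The integrable weight in which the decay of the kernel and of its Taylor remainders is
    measured. *)
Lemma integrable_oneDsqrV :
  mu.-integrable [set: RR] (EFin \o (fun z : R => (oneDsqr z)^-1)).
Proof.
have mf : measurable_fun [set: RR] (fun z : R => (oneDsqr z)^-1).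
  by apply: continuous_measurable_fun; exact: continuous_oneDsqrV.
have f0 : forall z : R, 0 <= (oneDsqr z)^-1.
  by move=> z; rewrite invr_ge0 (le_trans ler01)// oneDsqr_ge1.
apply/integrableP; split; first exact/measurable_EFinP.
have -> : (\int[mu]_x `|(EFin \o (fun z : R => (oneDsqr z)^-1%R)) x| =
    \int[mu]_x ((oneDsqr x)^-1)%:E)%E.
  by apply: eq_integral => z _ /=; rewrite ger0_norm.
rewrite ge0_symfun_integralT//.
- rewrite (_ : [set x | _] = `[0, +oo[%classic); last first.
    by apply/seteqP; split => x/=; rewrite in_itv/= andbT.
  by rewrite integral0y_oneDsqr -EFinM ltry.
- exact: continuous_oneDsqrV.
- by move=> z /=; rewrite /oneDsqr sqrrN.
Qed.

Lemma Rintegral_pos_neg D f :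
  \int[mu]_(x in D) f x = fine (\int[mu]_(x in D) (Num.max (f x) 0)%:E -
                                 \int[mu]_(x in D) (Num.max (- f x) 0)%:E)%E.
Proof.
rewrite /Rintegral integralE; congr (fine (_ - _)).
  by apply: eq_integral => x _; rewrite funeposE EFin_max.
by apply: eq_integral => x _; rewrite funenegE EFin_max.
Qed.

Lemma continuous_maxr0 G : continuous G -> continuous (fun x => Num.max (G x) 0).
Proof.
move=> cG x; apply: (@continuous_max _ _ G (cst 0) x); first exact: cG.
exact: cvg_cst.
Qed.

(** Positive and negative parts of a continuous function are continuous and commute with a
    nonnegative Jacobian [J], so a change of variables for nonnegative continuous integrands extends
    to signed ones. The two parts agree separately as extended reals, so divergent integrals are
    covered too. *)
Lemma eq_Rintegral_ge0 (D1 D2 : set RR) G1 G2 (s : R -> R) (J : R -> R) :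
  continuous G1 ->
  (forall x, D2 x -> 0 <= J x) ->
  (forall x, G2 x = G1 (s x) * J x) ->
  (forall H : R -> R, continuous H -> (forall x, 0 <= H x) ->
    (\int[mu]_(x in D1) (H x)%:E = \int[mu]_(x in D2) (H (s x) * J x)%:E)%E) ->
  \int[mu]_(x in D1) G1 x = \int[mu]_(x in D2) G2 x.
Proof.
move=> cG J0 G2E H; rewrite !Rintegral_pos_neg; congr (fine (_ - _)).
  rewrite (H (fun x => Num.max (G1 x) 0)); last 2 first.
    exact: continuous_maxr0.
    by move=> x; rewrite le_max lexx orbT.
  apply: eq_integral => x; rewrite inE => D2x; congr EFin.
  by rewrite G2E maxr_pMl ?mul0r// J0.
rewrite (H (fun x => Num.max (- G1 x) 0)); last 2 first.
  by apply: (@continuous_maxr0 (fun x => - G1 x)) => x; apply: cvgN; exact: cG.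
  by move=> x; rewrite le_max lexx orbT.
apply: eq_integral => x; rewrite inE => D2x; congr EFin.
by rewrite G2E -mulNr maxr_pMl ?mul0r// J0.
Qed.

Lemma Rintegral_affine G (c d : R) : 0 < d -> continuous G ->
  \int[mu]_x G x = \int[mu]_x (G (c + d * x) * d).
Proof.
move=> d0 cG; pose F (x : R) : R := c + d * x.
have dF (x : R) : is_derive x 1 F d.
  by rewrite /F; apply: is_derive_eq; rewrite /GRing.scale/=; ring.
have F'E : F^`()%classic = cst d.
  by apply/funext => x; rewrite derive1E; have [_ ->] := dF x.
apply: (@eq_Rintegral_ge0 _ _ _ _ F (cst d)) => //; first by move=> x _; exact: ltW.
move=> H cH H0.
rewrite (@increasing_ge0_integration_by_substitutionT _ F H) ?F'E//.
- by move=> x y xy; rewrite /F ltrD2l ltr_pM2l.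
- by move=> x; exact: cvg_cst.
- exact: is_cvg_cst.
- exact: is_cvg_cst.
- apply: (cvg_comp (fun x => d * x) (fun x => c + x)); last exact: cvg_addrl_Ny.
  by apply: gt0_cvgMrNy => //; exact: cvg_id.
- apply: (cvg_comp (fun x => d * x) (fun x => c + x)); last exact: cvg_addrl.
  by apply: gt0_cvgMry => //; exact: cvg_id.
Qed.

Lemma Rintegral_opp G : continuous G -> \int[mu]_x G x = \int[mu]_x G (- x).
Proof.
move=> cG; apply: (@eq_Rintegral_ge0 _ _ _ _ -%R (cst 1)) => //.
  by move=> x; rewrite /= mulr1.
move=> H cH H0.
under [RHS]eq_integral do rewrite /= mulr1.
have mH : measurable_fun [set: RR] (EFin \o H).
  by apply/measurable_EFinP; exact: continuous_measurable_fun.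
have mN : measurable_fun [set: RR] (-%R : RR -> RR) by exact: oppr_measurable.
rewrite -[in RHS](preimage_setT (-%R : _ -> RR)).
transitivity (\int[mu]_(x in -%R @^-1` [set: RR]) ((EFin \o H) \o -%R) x)%E => //.
rewrite -(ge0_integral_pushforward mN)//; last first.
  by move=> x _; rewrite /= lee_fin.
by apply: eq_measure_integral => //= A mA AS; exact/esym/lebesgue_measureN.
Qed.

Lemma Rintegral_shift G (c : R) : continuous G ->
  \int[mu]_x G x = \int[mu]_x G (x + c).
Proof.
move=> cG; rewrite (@Rintegral_affine G c 1)//.
by apply: eq_Rintegral => x _; rewrite mul1r mulr1 addrC.
Qed.

Lemma Rintegral_reflect_affine G (c d : R) : 0 < d -> continuous G ->
  \int[mu]_x G x = \int[mu]_x (G (c - d * x) * d).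
Proof.
move=> d0 cG; rewrite (@Rintegral_affine G c d)// Rintegral_opp.
  by apply: eq_Rintegral => x _; rewrite mulrN.
move=> x; apply: cvgM; last exact: cvg_cst.
apply: continuous_comp; last exact: cG.
by apply: cvgD; [exact: cvg_cst|apply: cvgM; [exact: cvg_cst|exact: cvg_id]].
Qed.

(** The substitution is made on [[0, n]], and both sides pass to the limit by monotone convergence,
    since the images [[0, c * n ^+ 3]] exhaust the half-line. *)
Lemma Rintegral_cube G (c : R) : 0 < c -> continuous G ->
  \int[mu]_(x in `[0, +oo[) G x =
  \int[mu]_(x in `[0, +oo[) (G (c * x ^+ 3) * (3 * c * x ^+ 2)).
Proof.
move=> c0 cG; pose F (x : R) : R := c * x ^+ 3; pose J (x : R) : R := 3 * c * x ^+ 2.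
have dF (x : R) : is_derive x 1 F (J x).
  rewrite /F; apply: is_derive_eq; rewrite /J /GRing.scale/=; ring.
have F'E : F^`()%classic = J.
  by apply/funext => x; rewrite derive1E; have [_ ->] := dF x.
have J0 x : 0 <= J x by rewrite /J mulr_ge0 ?sqr_ge0// mulr_ge0// ltW.
have cF : continuous F.
  by move=> x; apply/differentiable_continuous/derivable1_diffP; case: (dF x).
have cJ : continuous J.
  by move=> x; apply: cvgM; [exact: cvg_cst|exact: exprn_continuous].
apply: (@eq_Rintegral_ge0 _ _ _ _ F J) => // H cH H0.
have cHFJ : continuous (fun x => H (F x) * J x).
  by move=> x; apply: cvgM; [apply: continuous_comp; [exact: cF|exact: cH]|exact: cJ].
have F0 x : 0 <= x -> 0 <= F x.
  by move=> x0; rewrite /F mulr_ge0 ?exprn_ge0// ltW.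
have subst (n : nat) : (\int[mu]_(x in `[0%R, F n%:R]) (H x)%:E =
    \int[mu]_(x in `[0%R, n%:R]) (H (F x) * J x)%:E)%E.
  have -> : 0%R = F 0 by rewrite /F expr0n mulr0.
  rewrite (@integration_by_substitution_increasing _ F H 0 n%:R)//.
  - by rewrite F'E /F expr0n mulr0.
  - move=> x y; rewrite !in_itv/= => /andP[x0 _] /andP[y0 _] xy.
    by rewrite /F ltr_pM2l// ltrXn2r.
  - by rewrite F'E => x _; exact: cJ.
  - by rewrite F'E; apply/cvg_ex; exists (J 0); apply: cvg_at_right_filter; exact: cJ.
  - by rewrite F'E; apply/cvg_ex; exists (J n%:R); apply: cvg_at_left_filter; exact: cJ.
  - split.
    + by move=> x _; case: (dF x).
    + by apply: cvg_at_right_filter; exact: cF.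
    + by apply: cvg_at_left_filter; exact: cF.
  - by apply: continuous_subspaceT.
have mH : measurable_fun [set: RR] H by exact: continuous_measurable_fun.
have l1 : (\int[mu]_(x in `[0%R, F n%:R]) (H x)%:E)%E @[n --> \oo] -->
    (\int[mu]_(x in `[0%R, +oo[) (H (F x) * J x)%:E)%E.
  under eq_fun do rewrite subst.
  apply: (@ge0_cvgn_integral _ mu (fun x => H (F x) * J x)).
    by move=> x; rewrite mulr_ge0.
  exact: continuous_measurable_fun.
have l2 : (\int[mu]_(x in `[0%R, F n%:R]) (H x)%:E)%E @[n --> \oo] -->
    (\int[mu]_(x in \bigcup_n `[0%R, F n%:R]%classic) (H x)%:E)%E.
  apply: (@ge0_nondecreasing_set_cvg_integral _ _ _
    (fun n : nat => `[0%R, F n%:R]%classic : set (measurableTypeR R))) => //.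
  - move=> m n mn; apply/subsetPset; apply: subset_itvl; rewrite bnd_simp /F.
    by rewrite ler_pM2l// lerXn2r ?nnegrE ?ler_nat.
  - by move=> i; apply/measurable_EFinP; exact: measurable_funTS.
  - by move=> i x _; rewrite lee_fin.
have E : \bigcup_(n : nat) `[0%R, F n%:R]%classic = `[0%R, +oo[%classic.
  apply/seteqP; split => x /=; rewrite in_itv/= andbT.
    by move=> [n _] /=; rewrite in_itv/= => /andP[].
  (* For this [n] one has [x <= c * n <= c * n ^+ 3], the last step because [n >= 1]. *)
  move=> x0; exists (Num.truncn (x / c)).+1 => //=; rewrite in_itv/= x0/= /F.
  have h : x / c <= (Num.truncn (x / c)).+1%:R by rewrite ltW// truncnS_gt.
  rewrite -ler_pdivrMl// mulrC (le_trans h)// exprS ler_peMr//.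
  by rewrite exprn_ege1// ler1n.
by rewrite E in l2; move/cvg_lim : l2 => <-//; move/cvg_lim : l1 => <-.
Qed.

Lemma Rintegral_even G : continuous G -> (forall x, G (- x) = G x) ->
  \int[mu]_x G x = 2 * \int[mu]_(x in `[0, +oo[) G x.
Proof.
move=> cG evG.
have key (H : R -> R) : continuous H -> (forall x, 0 <= H x) -> (forall x, H (- x) = H x) ->
    (\int[mu]_x (H x)%:E = 2%:E * \int[mu]_(x in `[0%R, +oo[) (H x)%:E)%E.
  move=> cH H0 evH; rewrite ge0_symfun_integralT//.
    by rewrite (_ : [set x | _] = `[0, +oo[%classic)// set_itvcy.
  by move=> x /=; rewrite evH.
rewrite !Rintegral_pos_neg (key (fun x => Num.max (G x) 0)); last 3 first.
  exact: continuous_maxr0.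
  by move=> x; rewrite le_max lexx orbT.
  by move=> x; rewrite evG.
rewrite (key (fun x => Num.max (- G x) 0)); last 3 first.
  by apply: (@continuous_maxr0 (fun x => - G x)) => x; apply: cvgN; exact: cG.
  by move=> x; rewrite le_max lexx orbT.
  by move=> x; rewrite evG.
set I := (\int[mu]_(x in _) _)%E; set J := (\int[mu]_(x in _) _)%E.
have I0 : (0 <= I)%E.
  by apply: integral_ge0 => x _; rewrite lee_fin le_max lexx orbT.
have J0 : (0 <= J)%E.
  by apply: integral_ge0 => x _; rewrite lee_fin le_max lexx orbT.
(* [fine] sends infinite values to 0, so the cases with an infinite part read [0 = 2 * 0]. *)
move: I J I0 J0 => [i| |] [j| |] //= i0 j0.
- by rewrite -mulrBr.
- by rewrite mulry gtr0_sg// mul1e mulr0.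
- by rewrite mulry gtr0_sg// mul1e mulr0.
- by rewrite mulry gtr0_sg// mul1e mulr0.
Qed.

(** The integrands it is meant for oscillate, so the passage from [[0, n.+1]] to the half-line uses
    dominated convergence, with majorant [|f|]. *)
Lemma Rintegral_FTC0y (f F : R -> R) (l : R) :
  (forall x, is_derive x (1 : R) F (f x)) -> continuous f ->
  mu.-integrable `[0, +oo[ (EFin \o f) -> F x @[x --> +oo] --> l ->
  \int[mu]_(x in `[0, +oo[) f x = l - F 0.
Proof.
move=> dF cf intf Fl.
have F'E : F^`()%classic = f.
  by apply/funext => x; rewrite derive1E; have [_ ->] := dF x.
have cF : continuous F.
  by move=> x; apply/differentiable_continuous/derivable1_diffP; case: (dF x).
have mf : measurable_fun [set: RR] f by exact: continuous_measurable_fun.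
have ftc (n : nat) : \int[mu]_(x in `[0, n.+1%:R]) f x = F n.+1%:R - F 0.
  rewrite /Rintegral (@continuous_FTC2 _ f F)//.
  - exact: continuous_subspaceT.
  - split.
    + by move=> x _; case: (dF x).
    + by apply: cvg_at_right_filter; exact: cF.
    + by apply: cvg_at_left_filter; exact: cF.
  - by move=> x _; rewrite F'E.
have l1 : F n.+1%:R - F 0 @[n --> \oo] --> l - F 0.
  apply: cvgB; last exact: cvg_cst.
  have /cvg_pinftyP := Fl; apply.
  by rewrite (cvg_shiftS (fun n => n%:R : R)); exact: cvgr_idn.
have iT : mu.-integrable [set: RR] (EFin \o (f \_ `[0, +oo[)).
  by rewrite -restrict_EFin; apply/integrable_restrict; rewrite ?setTI.
pose f_ (n : nat) x : \bar R := ((f \_ `[0, n.+1%:R]) x)%:E.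
have mf_ n : measurable_fun [set: RR] (f_ n).
  apply/measurable_EFinP/measurable_restrict => //.
  by rewrite setTI; exact: measurable_funTS.
have c1 : {ae mu, forall x, [set: R] x -> f_ ^~ x @ \oo --> (EFin \o f \_ `[0, +oo[) x}.
  apply: aeW => x _; rewrite /f_ /=.
  have [x0|x0] := leP 0 x.
    have -> : (f \_ `[0, +oo[) x = f x by rewrite patchE mem_set//= in_itv/= x0.
    apply: cvg_near_cst; near=> n.
    rewrite patchE mem_set//= in_itv/= x0/=.
    near: n; exists (Num.truncn x) => // n /= hn.
    by rewrite (le_trans (ltW (truncnS_gt x)))// ler_nat.
  have -> : (f \_ `[0, +oo[) x = 0.
    by rewrite patchE memNset//= in_itv/= leNgt x0.
  apply: cvg_near_cst; near=> n.
  by rewrite patchE memNset//= in_itv/= leNgt x0.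
have c2 : {ae mu, forall x n, [set: R] x -> (`|f_ n x| <= `|(f \_ `[0%R, +oo[) x|%:E)%E}.
  apply: aeW => x n _; rewrite /f_ /= lee_fin !patchE.
  case: ifPn => h; last by rewrite normr0 normr_ge0.
  rewrite mem_set//; move: h; rewrite inE/= !in_itv/= => /andP[-> _].
  by [].
have [_ _ h] := @dominated_convergence _ _ _ mu setT measurableT f_
  (EFin \o (f \_ `[0, +oo[)) (fun x => (`|(f \_ `[0, +oo[) x|)%:E) mf_
  (measurable_int _ iT) c1 (integrable_norm iT) c2.
have E : (\int[mu]_x ((f \_ `[0%R, +oo[) x)%:E)%E = (\int[mu]_(x in `[0, +oo[) f x)%:E.
  rewrite Rintegral_mkcond fineK//; exact: integrable_fin_num.
have {}h : \int[mu]_(x in `[0, n.+1%:R]) f x @[n --> \oo] --> \int[mu]_(x in `[0, +oo[) f x.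
  apply: fine_cvg; rewrite -E.
  apply: cvg_trans h; apply: near_eq_cvg; near=> n.
  rewrite /f_ [RHS]/=.
  rewrite /= [RHS]integral_mkcond; apply: eq_integral => x _.
  by rewrite restrict_EFin.
move/cvg_lim : h => <-//; apply/cvg_lim => //.
by under eq_fun do rewrite ftc.
Unshelve. all: end_near. Qed.

Lemma measurable_norm_gt (M : R) : measurable ([set x | M < `|x|] : set RR).
Proof.
rewrite (_ : [set x | _] = [set: RR] `&` (fun x => M < `|x|) @^-1` [set true]).
  by apply: measurable_fun_ltr => //; exact: measurableT_comp.
by apply/seteqP; split=> x /=; [move=> -> | case].
Qed.

Lemma Rintegral_tail (w : R -> R) (e : R) : 0 < e ->
  mu.-integrable [set: RR] (EFin \o w) -> (forall x, 0 <= w x) ->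
  exists M : R, 0 < M /\ \int[mu]_x (w \_ [set x | M < `|x|]) x < e.
Proof.
move=> e0 iw w0.
pose f_ (n : nat) x : \bar R := ((w \_ [set x | n.+1%:R < `|x|]) x)%:E.
have mw : measurable_fun [set: RR] w by have /measurable_int/measurable_EFinP := iw.
have mf_ n : measurable_fun [set: RR] (f_ n).
  apply/measurable_EFinP/measurable_restrict => //; first exact: measurable_norm_gt.
  by rewrite setTI; exact: measurable_funTS.
have c1 : {ae mu, forall x, [set: RR] x -> f_ ^~ x @ \oo --> (cst 0%E : R -> \bar R) x}.
  apply: aeW => x _; rewrite /f_ /=.
  apply: cvg_near_cst; near=> n.
  rewrite patchE memNset//=; apply/negP; rewrite -leNgt.
  near: n; exists (Num.truncn `|x|) => // n /= hn.
  by rewrite (le_trans (ltW (truncnS_gt _)))// ler_nat.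
have c2 : {ae mu, forall x n, [set: RR] x -> (`|f_ n x| <= (w x)%:E)%E}.
  apply: aeW => x n _; rewrite /f_ /= lee_fin !patchE.
  by case: ifPn => h; rewrite ?normr0// ger0_norm.
have [_ _ h] := @dominated_convergence _ _ _ mu setT measurableT f_
  (cst 0%E) (EFin \o w) mf_ (measurable_cst _) c1 iw c2.
have {}h : \int[mu]_x (w \_ [set x | n.+1%:R < `|x|]) x @[n --> \oo] --> (0 : R).
  apply: fine_cvg; rewrite integral0 in h.
  apply: cvg_trans h; apply: near_eq_cvg; near=> n.
  by [].
have /cvgrPdist_lt/(_ _ e0)[n _ /(_ n (leqnn n))/=] := h.
rewrite sub0r normrN => hn; exists n.+1%:R; split => //.
by rewrite (le_lt_trans (ler_norm _)).
Unshelve. all: end_near. Qed.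

(* Uniformity in [h] is what makes this usable where dominated convergence,
   stated along a sequence, is not. *)
Lemma Rintegral_split (w : R -> R) (B e : R) : 0 < e -> 0 <= B ->
  mu.-integrable [set: RR] (EFin \o w) -> (forall x, 0 <= w x) ->
  exists M : R, 0 < M /\ forall (h : R -> R) (d : R),
    measurable_fun [set: RR] h -> 0 <= d ->
    (forall z, `|h z| <= B * w z) ->
    (forall z, `|z| <= M -> `|h z| <= d * w z) ->
    `|\int[mu]_z h z| <= d * \int[mu]_z w z + e.
Proof.
move=> e0 B0 iw w0.
(* Dividing by [B + 1] instead of [B] covers [B = 0]; the device recurs with other constants
   below. *)
have B10 : 0 < B + 1 by rewrite ltr_wpDl.
have [M [M0 hM]] := Rintegral_tail (divr_gt0 e0 B10) iw w0.
exists M; split => // h d mh d0 h1 h2.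
have mS := measurable_norm_gt M.
have it : mu.-integrable [set: RR] (EFin \o (w \_ [set x | M < `|x|])).
  apply: (integrable_dominated _ _ iw) => //.
    apply/measurable_restrict => //.
    by rewrite setTI; apply: measurable_funTS; have /measurable_int/measurable_EFinP := iw.
  by move=> x _; rewrite patchE; case: ifPn => _; rewrite ?normr0// ger0_norm.
have i1 : mu.-integrable [set: RR] (EFin \o (fun x => d * w x)).
  exact: (integrableZl measurableT d iw).
have i2 : mu.-integrable [set: RR] (EFin \o (fun x => B * (w \_ [set x | M < `|x|]) x)).
  exact: (integrableZl measurableT B it).
apply: (le_trans (@normr_Rintegral_dominated setT h
   (fun x => d * w x + B * (w \_ [set x | M < `|x|]) x) measurableT mh _ _)).
- exact: (integrableD measurableT i1 i2).
- move=> x _; rewrite patchE; case: ifPn => [_|].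
    by rewrite (le_trans (h1 x))// lerDr mulr_ge0.
  move=> /negP; rewrite inE/= => /negP; rewrite -leNgt => xM.
  by rewrite mulr0 addr0 h2.
rewrite RintegralD// RintegralZl// RintegralZl// lerD2l.
rewrite (@le_trans _ _ (B * (e / (B + 1))))//.
  by rewrite ler_wpM2l// ltW.
by rewrite mulrA ler_pdivrMr// mulrDr mulr1 mulrC lerDl ltW.
Qed.

End integrals.

(** * Mean value inequalities *)

Section mean_value.
Context {R : realType}.
Implicit Types f g : R -> R.

Lemma MVT_bound f g (x h K : R) : (forall t, is_derive t (1 : R) f (g t)) ->
  (forall t, `|t - x| <= `|h| -> `|g t| <= K) ->
  `|f (x + h) - f x| <= K * `|h|.
Proof.
move=> df hK.
have cf : continuous f.
  by move=> t; apply/differentiable_continuous/derivable1_diffP; case: (df t).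
have [h0|h0] := leP 0 h.
  have [//| |c + ->] := @MVT_segment _ f g x (x + h) _ (fun t _ => df t).
  - by rewrite lerDl.
  - exact: continuous_subspaceT.
  rewrite in_itv/= => /andP[c1 c2].
  rewrite addrAC subrr add0r normrM ler_wpM2r// hK//.
  by rewrite ger0_norm ?subr_ge0// (ger0_norm h0) lerBlDl.
rewrite distrC.
have [//| |c + ->] := @MVT_segment _ f g (x + h) x _ (fun t _ => df t).
- by rewrite gerDl ltW.
- exact: continuous_subspaceT.
rewrite in_itv/= => /andP[c1 c2].
rewrite opprD addNKr normrM normrN ler_wpM2r// hK//.
rewrite distrC ger0_norm ?subr_ge0// (ltr0_norm h0).
lra.
Qed.

(** The mean value bound for [f t - t * g x], whose derivative is the oscillation of [g]. It turns
    uniform continuity of a derivative into uniform convergence of difference quotients. *)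
Lemma Taylor1_bound f g (x h K : R) : (forall t, is_derive t (1 : R) f (g t)) ->
  (forall t, `|t - x| <= `|h| -> `|g t - g x| <= K) ->
  `|f (x + h) - f x - h * g x| <= K * `|h|.
Proof.
move=> df hK.
have dg t : is_derive t (1 : R) (fun t => f t - t * g x) (g t - g x).
  have := df t => ?.
  apply: is_derive_eq; rewrite /GRing.scale/=; ring.
have := MVT_bound dg hK; rewrite /=; congr (`|_| <= _); ring.
Qed.

Lemma ler_normDD (x y c d : R) : `|x| <= c -> `|y| <= d -> `|x + y| <= c + d.
Proof. by move=> xc yd; rewrite (le_trans (ler_normD _ _))// lerD. Qed.

Lemma normr_cosB_le (x y : R) : `|cos x - cos y| <= `|x - y|.
Proof.
rewrite -[in cos x](subrK y x) addrC -[leRHS]mul1r.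
rewrite (addrC (- _)) (addrC (x - y)).
have dc (t : R) : is_derive t (1 : R) cos (- sin t) by exact: is_derive_cos.
apply: (MVT_bound dc) => t _; rewrite normrN.
by rewrite ler_norml sin_geN1 sin_le1.
Qed.

(** By convexity the larger endpoint value suffices; the sum is symmetric in [x] and [y], and in
    [osc_lipschitz] each summand has its own decay. *)
Lemma normr_expRB_le (x y : R) :
  `|expR x - expR y| <= (expR x + expR y) * `|x - y|.
Proof.
wlog xy : x y / x <= y.
  move=> H; case: (leP x y) => [|/ltW] xy; first exact: H.
  by rewrite distrC [X in X * _]addrC [X in _ * X]distrC H.
rewrite distrC ger0_norm ?subr_ge0 ?ler_expR// distrC ger0_norm ?subr_ge0//.
have h : expR y - expR x <= expR y * (y - x).
  have := expR_ge1Dx (x - y); rewrite expRB -(@ler_pM2l _ (expR y)) ?expR_gt0//.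
  rewrite mulrCA mulfV ?gt_eqF ?expR_gt0// mulr1; lra.
rewrite (le_trans h)// ler_wpM2r ?subr_ge0//.
by rewrite lerDr expR_ge0.
Qed.

End mean_value.

Lemma is_derive_exprn {R : realType} (n : nat) (z : R) :
  is_derive z (1 : R) (fun z : R => z ^+ n) (n%:R * z ^+ n.-1).
Proof.
have h := @is_derive_poly R 'X^n z; apply: is_derive_eq.
- rewrite (_ : (fun z : R => z ^+ n) = horner 'X^n); first exact: h.
  by apply/funext => x; rewrite hornerXn.
- by rewrite derivXn hornerMn hornerXn mulr_natl.
Qed.

(** * Oscillatory integrals *)

Section oscillatory.
Context {R : realType}.
Local Notation mu := (@lebesgue_measure R).
Local Notation RR := (measurableTypeR R).
Variables a b : R.

Definition amplitude (s z : R) : R := expR (- z ^+ 6 + s * a * z ^+ 4).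

(** [y] is the rescaled position and [s] stands for [tau ^+ 2]. The free shift [q] keeps sines,
    cosines and all [y]-derivatives in one family: each derivative adds [pi / 2] to it. *)
Definition phase (y s q z : R) : R := y * z ^+ 3 + s * b * z ^+ 4 + q.

Definition osc_fun (m : nat) (y s q z : R) : R :=
  z ^+ m * amplitude s z * cos (phase y s q z).

Definition osc (m : nat) (y s q : R) : R :=
  \int[mu]_(z in `[0, +oo[) osc_fun m y s q z.

(** The power bounds [|z| ^+ m * (1 + z ^+ 2) * exp (- z ^+ 2)]; the exponent bounds
    [- u ^+ 3 + |a| * u ^+ 2 + u] over [u >= 0]. *)
Definition amp_bound (m : nat) : R :=
  m.+1%:R ^+ m.+1 * expR (`|a| * (`|a| + 1) ^+ 2 + (`|a| + 1)).

Lemma amp_bound_ge0 m : 0 <= amp_bound m.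
Proof. by rewrite mulr_ge0 ?expR_ge0// exprn_ge0. Qed.

(** With [u = z ^+ 2] and [A = |a|], the cubic [- u ^+ 3 + A * u ^+ 2 + u] is bounded: for
    [u <= A + 1] the first term is dropped, and beyond that [u ^+ 3 >= (A + 1) * u ^+ 2] absorbs the
    other two. *)
Lemma amplitude_le (s z : R) : `|s| <= 1 ->
  amplitude s z <= expR (`|a| * (`|a| + 1) ^+ 2 + (`|a| + 1)) * expR (- z ^+ 2).
Proof.
move=> s1; rewrite -expRD ler_expR.
set A := `|a|; have A0 : 0 <= A by exact: normr_ge0.
pose u := z ^+ 2; have u0 : 0 <= u by exact: sqr_ge0.
have sa : s * a <= A.
  by rewrite (le_trans (ler_norm _))// normrM ler_piMl.
have -> : z ^+ 6 = u ^+ 3 by rewrite -exprM.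
have -> : z ^+ 4 = u ^+ 2 by rewrite -exprM.
rewrite -/u.
have h1 : s * a * u ^+ 2 <= A * u ^+ 2 by rewrite ler_wpM2r ?sqr_ge0.
suff h : - u ^+ 3 + A * u ^+ 2 + u <= A * (A + 1) ^+ 2 + (A + 1) by lra.
have [uA|uA] := leP u (A + 1).
  have h2 : u ^+ 2 <= (A + 1) ^+ 2 by rewrite lerXn2r// nnegrE addr_ge0.
  have h3 : A * u ^+ 2 <= A * (A + 1) ^+ 2 by rewrite ler_wpM2l.
  have h4 : 0 <= u ^+ 3 by rewrite exprn_ge0.
  lra.
have h2 : (A + 1) * u ^+ 2 <= u ^+ 3.
  by rewrite [u ^+ 3]exprS ler_wpM2r ?sqr_ge0// ltW.
have h3 : u <= u ^+ 2 by rewrite expr2 ler_peMr//; lra.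
have h4 : 0 <= A * (A + 1) ^+ 2 by rewrite mulr_ge0 ?sqr_ge0.
lra.
Qed.

(** Since [|z| <= 1 + z ^+ 2], it is enough to bound [(1 + z ^+ 2) ^+ m.+1] by a multiple of
    [exp (z ^+ 2)], which is the power [m.+1] of [1 + z ^+ 2 <= m.+1 * exp (z ^+ 2 / m.+1)]. *)
Lemma exprn_expR_le (m : nat) (z : R) :
  `|z| ^+ m * expR (- z ^+ 2) <= m.+1%:R ^+ m.+1 / oneDsqr z.
Proof.
pose u := z ^+ 2; have u0 : 0 <= u by exact: sqr_ge0.
have d0 : 0 < oneDsqr z by rewrite (lt_le_trans ltr01)// oneDsqr_ge1.
have h1 : `|z| <= oneDsqr z.
  have : 0 <= (`|z| - 1) ^+ 2 by exact: sqr_ge0.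
  rewrite sqrrB1 /oneDsqr -(real_normK (num_real z)).
  have := normr_ge0 z; lra.
rewrite ler_pdivlMr// mulrAC expRN ler_pdivrMr ?expR_gt0//.
rewrite (@le_trans _ _ (oneDsqr z ^+ m.+1))//.
  by rewrite [leRHS]exprSr ler_wpM2r ?(ltW d0)// lerXn2r// nnegrE// ltW.
have h2 : oneDsqr z <= m.+1%:R * expR (u / m.+1%:R).
  rewrite (@le_trans _ _ (m.+1%:R * (1 + u / m.+1%:R)))//; last first.
    by rewrite ler_wpM2l// expR_ge1Dx.
  rewrite mulrDr mulr1 mulrCA divff ?mulr1 ?pnatr_eq0// lerD2r.
  by rewrite ler1n.
rewrite (@le_trans _ _ ((m.+1%:R * expR (u / m.+1%:R)) ^+ m.+1))//.
  by rewrite lerXn2r// nnegrE ?mulr_ge0 ?expR_ge0// ltW.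
rewrite exprMn -expRM_natl mulrCA divff ?mulr1 ?pnatr_eq0//.
Qed.

Lemma amplitude_decay (m : nat) (s z : R) : `|s| <= 1 ->
  `|z ^+ m * amplitude s z| <= amp_bound m * (oneDsqr z)^-1.
Proof.
move=> s1; rewrite normrM normrX (ger0_norm (expR_ge0 _)).
apply: (le_trans (ler_wpM2l _ (amplitude_le z s1))); first exact: exprn_ge0.
rewrite mulrCA /amp_bound mulrAC mulrC ler_wpM2r ?expR_ge0//.
exact: exprn_expR_le.
Qed.

Lemma osc_fun_le (m : nat) (y s q z : R) : `|s| <= 1 ->
  `|osc_fun m y s q z| <= amp_bound m * (oneDsqr z)^-1.
Proof.
move=> s1; rewrite /osc_fun normrM.
apply: (le_trans _ (amplitude_decay m z s1)).
by rewrite ler_piMr// cos_max.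
Qed.

Lemma continuous_osc_fun m y s q : continuous (osc_fun m y s q).
Proof.
move=> z; apply/differentiable_continuous/derivable1_diffP.
have dn := is_derive_exprn m z.
by rewrite /osc_fun /amplitude /phase; apply: ex_derive.
Qed.

Lemma measurable_osc_fun (D : set RR) m y s q : measurable_fun D (osc_fun m y s q).
Proof. apply: measurable_funTS; apply: continuous_measurable_fun.
exact: continuous_osc_fun. Qed.

Lemma integrable_oneDsqrV0y (c : R) :
  mu.-integrable `[0, +oo[ (EFin \o (fun z : R => c * (oneDsqr z)^-1)).
Proof.
have h := @integrableS _ _ _ mu _ _ _ measurableT (measurable_itv `[0, +oo[)
  (@subsetT _ _) (@integrable_oneDsqrV R).
by apply: (integrableZl _ c h); exact: measurable_itv.
Qed.

Lemma integrable_osc_fun m y s q : `|s| <= 1 ->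
  mu.-integrable `[0, +oo[ (EFin \o osc_fun m y s q).
Proof.
move=> s1; apply: (@integrable_dominated _ _ _ (fun z => amp_bound m * (oneDsqr z)^-1)) => //.
- exact: measurable_osc_fun.
- exact: integrable_oneDsqrV0y.
- by move=> z _; exact: osc_fun_le.
Qed.

Lemma Rintegral_oneDsqrV0y (c : R) :
  \int[mu]_(z in `[0, +oo[) (c * (oneDsqr z)^-1) = c * (pi / 2).
Proof.
rewrite RintegralZl//.
  by congr (_ * _); rewrite /Rintegral integral0y_oneDsqr.
have := integrable_oneDsqrV0y 1; apply: eq_integrable => // z _ /=.
by rewrite mul1r.
Qed.

Lemma osc_bound m y s q : `|s| <= 1 -> `|osc m y s q| <= amp_bound m * (pi / 2).
Proof.
move=> s1; rewrite -Rintegral_oneDsqrV0y.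
apply: normr_Rintegral_dominated => //.
- exact: measurable_osc_fun.
- exact: integrable_oneDsqrV0y.
- by move=> z _; exact: osc_fun_le.
Qed.

(** Varying [s] brings down a factor [z ^+ 4], hence the moment [m + 4]. The coefficient [a] is
    counted twice because [normr_expRB_le] charges the amplitudes at both [s] and [s']. *)
Lemma osc_lipschitz m y s s' q : `|s| <= 1 -> `|s'| <= 1 ->
  `|osc m y s q - osc m y s' q| <=
    (2 * `|a| + `|b|) * amp_bound (m + 4) * (pi / 2) * `|s - s'|.
Proof.
move=> s1 s1'; rewrite /osc -RintegralB//; last 2 first.
  exact: integrable_osc_fun.
  exact: integrable_osc_fun.
have -> : (2 * `|a| + `|b|) * amp_bound (m + 4) * (pi / 2) * `|s - s'| =
  `|s - s'| * ((2 * `|a| + `|b|) * amp_bound (m + 4)) * (pi / 2).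
  by move: (amp_bound _) => C; ring.
rewrite -Rintegral_oneDsqrV0y.
apply: normr_Rintegral_dominated => //.
- by apply: measurable_funB; exact: measurable_osc_fun.
- exact: integrable_oneDsqrV0y.
move=> z; rewrite /= in_itv/= andbT => z0; rewrite /osc_fun.
have -> : z ^+ m * amplitude s z * cos (phase y s q z) -
  z ^+ m * amplitude s' z * cos (phase y s' q z) =
  z ^+ m * ((amplitude s z - amplitude s' z) * cos (phase y s q z) +
  amplitude s' z * (cos (phase y s q z) - cos (phase y s' q z))) by ring.
have z40 : 0 <= z ^+ 4 by rewrite exprn_ge0.
have h1 : `|amplitude s z - amplitude s' z| <=
    (amplitude s z + amplitude s' z) * (`|a| * z ^+ 4 * `|s - s'|).
  apply: (le_trans (normr_expRB_le _ _)); rewrite ler_wpM2l//.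
  have -> : - z ^+ 6 + s * a * z ^+ 4 - (- z ^+ 6 + s' * a * z ^+ 4) =
    a * z ^+ 4 * (s - s') by ring.
  by rewrite normrM normrM (ger0_norm (x := z ^+ 4)).
have h2 : `|cos (phase y s q z) - cos (phase y s' q z)| <= `|b| * z ^+ 4 * `|s - s'|.
  apply: (le_trans (normr_cosB_le _ _)).
  have -> : phase y s q z - phase y s' q z = b * z ^+ 4 * (s - s').
    by rewrite /phase; ring.
  by rewrite normrM normrM (ger0_norm (x := z ^+ 4)).
have zm : 0 <= z ^+ m by rewrite exprn_ge0.
rewrite normrM (ger0_norm zm).
apply: (@le_trans _ _ (z ^+ m * ((amplitude s z + amplitude s' z) * (`|a| * z ^+ 4 * `|s - s'|)
   + amplitude s' z * (`|b| * z ^+ 4 * `|s - s'|)))).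
  rewrite ler_wpM2l// (le_trans (ler_normD _ _))// lerD//.
    rewrite normrM (le_trans _ h1)// ler_piMr// cos_max//.
  by rewrite normrM (ger0_norm (expR_ge0 _)) ler_wpM2l// expR_ge0.
have h3 := amplitude_decay (m + 4) z s1.
have h4 := amplitude_decay (m + 4) z s1'.
have zm4 : 0 <= z ^+ (m + 4) by rewrite exprn_ge0.
rewrite normrM (ger0_norm zm4) (ger0_norm (expR_ge0 _)) in h3.
rewrite normrM (ger0_norm zm4) (ger0_norm (expR_ge0 _)) in h4.
rewrite -/(amplitude _ _) in h3; rewrite -/(amplitude _ _) in h4.
move: h3 h4; set C := amp_bound _ * _; move=> h3 h4.
have -> : z ^+ m * ((amplitude s z + amplitude s' z) * (`|a| * z ^+ 4 * `|s - s'|)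
   + amplitude s' z * (`|b| * z ^+ 4 * `|s - s'|)) =
   (`|a| * (z ^+ (m + 4) * amplitude s z) +
   (`|a| + `|b|) * (z ^+ (m + 4) * amplitude s' z)) * `|s - s'|.
  by rewrite exprD; ring.
have -> : `|s - s'| * ((2 * `|a| + `|b|) * amp_bound (m + 4)) * (oneDsqr z)^-1 =
   (`|a| * C + (`|a| + `|b|) * C) * `|s - s'| by rewrite /C; ring.
rewrite ler_wpM2r// lerD// ler_wpM2l// addr_ge0//.
Qed.

Lemma is_derive_osc m y s q : `|s| <= 1 ->
  is_derive y (1 : R) (fun y => osc m y s q) (osc (m + 3) y s (q + pi / 2)).
Proof.
move=> s1.
pose f y z := osc_fun m y s q z.
have df (t z : R) : is_derive t (1 : R) (f ^~ z) (osc_fun (m + 3) t s (q + pi / 2) z).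
  rewrite /f /osc_fun /phase; apply: is_derive_eq.
  rewrite addrA cosDpihalf exprD /GRing.scale/=; ring.
have d1 t z : partial1of2 f t z = osc_fun (m + 3) t s (q + pi / 2) z.
  by rewrite partial1of2E; have [_ ->] := df t z.
have Iy : `]y - 1, y + 1[%classic y.
  by rewrite /= in_itv/= ltrBlDr ltrDl ltr01.
have i0 t : `]y - 1, y + 1[%classic t -> mu.-integrable `[0, +oo[ (EFin \o f t).
  by move=> _; exact: integrable_osc_fun.
have der t z : `]y - 1, y + 1[%classic t -> `[0, +oo[%classic z -> derivable (f ^~ z) t 1.
  by move=> _ _; case: (df t z).
pose G z : R := amp_bound (m + 3) * (oneDsqr z)^-1.
have G0 z : 0 <= G z.
  by rewrite mulr_ge0 ?amp_bound_ge0// invr_ge0 (le_trans ler01)// oneDsqr_ge1.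
have Gub t z : `]y - 1, y + 1[%classic t -> `[0, +oo[%classic z ->
    `|partial1of2 f t z| <= G z.
  by move=> _ _; rewrite d1; exact: osc_fun_le.
have mI := measurable_itv `[(0 : R), +oo[.
have D := @derivable_under_integral _ _ _ mu f _ mI y _ _ Iy i0 der G G0
  (integrable_oneDsqrV0y _) Gub.
have E := @differentiation_under_integral _ _ _ mu f _ mI y _ _ Iy i0 der G G0
  (integrable_oneDsqrV0y _) Gub.
apply: DeriveDef; first exact: D.
rewrite -derive1E E; apply: eq_Rintegral => z _; exact: d1.
Qed.

Lemma osc_fun_cvg0 m y s q : `|s| <= 1 -> osc_fun m y s q z @[z --> +oo] --> (0 : R).
Proof.
move=> s1; apply/cvgr0Pnorm_lt => e e0; near=> z.
apply: (le_lt_trans (osc_fun_le m y q z s1)).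
have z1 : 1 <= z by near: z; exact: nbhs_pinfty_ge.
have zC : amp_bound m / e < z by near: z; apply: nbhs_pinfty_gt; exact: num_real.
have zz : z <= oneDsqr z.
  by rewrite /oneDsqr expr2 (le_trans (_ : z <= z * z)) ?ler_peMr ?lerDr// (le_trans ler01).
rewrite ltr_pdivrMr; last by rewrite (lt_le_trans ltr01)// oneDsqr_ge1.
by rewrite -ltr_pdivrMl// mulrC (lt_le_trans zC).
Unshelve. all: end_near. Qed.

(** The integral over the half-line of the derivative of [z ^+ n * amplitude s z * sin (phase y s q
    z)], the sine being a cosine shifted by [- pi / 2]. The terms come from [z ^+ n], [- z ^+ 6],
    and the quartic and cubic terms; the boundary value at 0 survives only for [n = 0], and there
    the term in [n.-1] has coefficient 0. *)
Lemma osc_parts n y s q : `|s| <= 1 ->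
  3 * y * osc (n + 2) y s q = - ((n == 0)%:R * sin q)
   - n%:R * osc n.-1 y s (q - pi / 2) + 6 * osc (n + 5) y s (q - pi / 2)
   - 4 * (s * a) * osc (n + 3) y s (q - pi / 2) - 4 * (s * b) * osc (n + 3) y s q.
Proof.
move=> s1.
pose T (c : R) k q' z := c * osc_fun k y s q' z.
pose f z := T n%:R n.-1 (q - pi / 2) z + T (- 6) (n + 5)%N (q - pi / 2) z +
  T (4 * (s * a)) (n + 3)%N (q - pi / 2) z + T (3 * y) (n + 2)%N q z +
  T (4 * (s * b)) (n + 3)%N q z.
have dF (z : R) : is_derive z (1 : R) (osc_fun n y s (q - pi / 2)) (f z).
  have dn := is_derive_exprn n z.
  rewrite /osc_fun /amplitude /phase; apply: is_derive_eq.
  rewrite /f /T /osc_fun /amplitude /phase !addrA cosBpihalf sinBpihalf !exprD /GRing.scale/=.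
  move: (expR _) (cos _) (sin _) => e C S.
  ring.
have mI : measurable (`[0, +oo[%classic : set RR) by exact: measurable_itv.
have iT c k q' : mu.-integrable `[0, +oo[ (EFin \o T c k q').
  exact: (integrableZl mI c (@integrable_osc_fun k y s q' s1)).
have ET c k q' : \int[mu]_(z in `[0, +oo[) T c k q' z = c * osc k y s q'.
  by rewrite RintegralZl//; exact: integrable_osc_fun.
have i2 := integrableD mI (iT n%:R n.-1 (q - pi / 2)) (iT (- 6) (n + 5)%N (q - pi / 2)).
have i3 := integrableD mI i2 (iT (4 * (s * a)) (n + 3)%N (q - pi / 2)).
have i4 := integrableD mI i3 (iT (3 * y) (n + 2)%N q).
have i5 := integrableD mI i4 (iT (4 * (s * b)) (n + 3)%N q).
have cT c k q' : continuous (T c k q').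
  by move=> z; apply: cvgM; [exact: cvg_cst|exact: continuous_osc_fun].
have cf : continuous f.
  by move=> z; do 4 ?[apply: cvgD]; exact: cT.
have := Rintegral_FTC0y dF cf i5 (osc_fun_cvg0 n y (q - pi / 2) s1).
rewrite /f !RintegralD// !ET.
have -> : osc_fun n y s (q - pi / 2) 0 = (n == 0)%:R * sin q.
  rewrite /osc_fun /amplitude /phase !expr0n/= !mulr0 oppr0 !add0r expR0 mulr1.
  by rewrite cosBpihalf.
lra.
Qed.

Let B k := amp_bound k * (pi / 2).

Let B_ge0 k : 0 <= B k.
Proof. by rewrite mulr_ge0 ?amp_bound_ge0// divr_ge0 ?pi_ge0. Qed.

(** One integration by parts trades the factor [y] for moments bounded uniformly in [y]. The bound
    [2 <= m] provides the [z ^+ 2] that comes from differentiating the cubic phase. *)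
Lemma osc_decay1 m : (2 <= m)%N ->
  exists2 C, 0 <= C & forall y s q, `|s| <= 1 -> `|y * osc m y s q| <= C.
Proof.
move=> m2; have [n ->] : exists n, m = (n + 2)%N by exists (m - 2)%N; rewrite subnK.
exists (1 + n%:R * B n.-1 + 6 * B (n + 5) + 4 * `|a| * B (n + 3) + 4 * `|b| * B (n + 3)).
  by rewrite !addr_ge0// mulr_ge0// mulr_ge0.
move=> y s q s1.
have sc (c : R) : `|4 * (s * c)| <= 4 * `|c|.
  by rewrite normrM ger0_norm// ler_wpM2l// normrM ler_piMl.
rewrite (@le_trans _ _ `|3 * y * osc (n + 2) y s q|)//.
  by rewrite -mulrA [leRHS]normrM ger0_norm// ler_peMl// ler1n.
rewrite osc_parts//.
have -> : - ((n == 0)%:R * sin q)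
   - n%:R * osc n.-1 y s (q - pi / 2) + 6 * osc (n + 5) y s (q - pi / 2)
   - 4 * (s * a) * osc (n + 3) y s (q - pi / 2) - 4 * (s * b) * osc (n + 3) y s q =
   - ((n == 0)%:R * sin q)
   + (- n%:R) * osc n.-1 y s (q - pi / 2) + 6 * osc (n + 5) y s (q - pi / 2)
   + (- (4 * (s * a))) * osc (n + 3) y s (q - pi / 2)
   + (- (4 * (s * b))) * osc (n + 3) y s q by ring.
have T c k q' : `|c * osc k y s q'| <= `|c| * B k.
  by rewrite normrM ler_wpM2l// osc_bound.
repeat apply: ler_normDD.
- rewrite normrN normrM; case: (n == 0%N); rewrite ?normr0 ?mul0r ?ler01// normr1 mul1r.
  by rewrite ler_norml sin_geN1 sin_le1.
- by rewrite (le_trans (T _ _ _))// normrN normr_nat.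
- by rewrite (le_trans (T _ _ _))// ger0_norm.
- by rewrite (le_trans (T _ _ _))// ler_wpM2r// normrN.
- by rewrite (le_trans (T _ _ _))// ler_wpM2r// normrN.
Qed.

(** A second factor [y] multiplies every term of [osc_parts]. The boundary term must therefore
    vanish, and each remaining moment must be at least 2 for [osc_decay1] to apply; for [n.-1] this
    means [3 <= n], unless [n = 0] kills the term. *)
Lemma osc_decay2 n q : (n == 0)%:R * sin q = 0 -> (n == 0)%N || (3 <= n)%N ->
  exists2 C, 0 <= C & forall y s, `|s| <= 1 -> `|y ^+ 2 * osc (n + 2) y s q| <= C.
Proof.
move=> q0 n3.
have [C1 C10 h1] : exists2 C, 0 <= C & forall y s q, `|s| <= 1 ->
    n%:R * `|y * osc n.-1 y s q| <= C.
  case/orP: n3 => [/eqP ->|n3].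
    by exists 0 => // y s q' _; rewrite mul0r.
  have [|C C0 h] := @osc_decay1 n.-1; first by lia.
  by exists (n%:R * C); rewrite ?mulr_ge0// => y s q' s1; rewrite ler_wpM2l// h.
have [|C2 C20 h2] := @osc_decay1 (n + 5); first by lia.
have [|C3 C30 h3] := @osc_decay1 (n + 3); first by lia.
exists (C1 + 6 * C2 + 4 * `|a| * C3 + 4 * `|b| * C3).
  by rewrite !addr_ge0// ?mulr_ge0// mulr_ge0.
move=> y s s1.
have sc (c : R) : `|4 * (s * c)| <= 4 * `|c|.
  by rewrite normrM ger0_norm// ler_wpM2l// normrM ler_piMl.
rewrite (@le_trans _ _ `|y * (3 * y * osc (n + 2) y s q)|)//.
  rewrite (_ : y * _ = 3 * (y ^+ 2 * osc (n + 2) y s q)); last by ring.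
  by rewrite [leRHS]normrM ger0_norm// ler_peMl// ler1n.
rewrite osc_parts// q0 oppr0 sub0r.
have -> : y * (- (n%:R * osc n.-1 y s (q - pi / 2)) + 6 * osc (n + 5) y s (q - pi / 2)
   - 4 * (s * a) * osc (n + 3) y s (q - pi / 2) - 4 * (s * b) * osc (n + 3) y s q) =
   - n%:R * (y * osc n.-1 y s (q - pi / 2)) + 6 * (y * osc (n + 5) y s (q - pi / 2))
   + (- (4 * (s * a))) * (y * osc (n + 3) y s (q - pi / 2))
   + (- (4 * (s * b))) * (y * osc (n + 3) y s q) by ring.
repeat apply: ler_normDD.
- by rewrite normrM normrN normr_nat h1.
- by rewrite normrM ger0_norm// ler_wpM2l// h2.
- by rewrite normrM normrN ler_pM// h3.
- by rewrite normrM normrN ler_pM// h3.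
Qed.

(** Both conditions of [osc_decay2] hold at [n = 3 * j]: for [j = 0] the shift is 0 and [sin 0 = 0],
    and for [j > 0] the exponent is at least 3. Near [y = 0] the plain bound takes over. *)
Lemma osc_decay j : exists2 C, 0 <= C & forall y s, `|s| <= 1 ->
  `|osc (3 * j + 2) y s (j%:R * (pi / 2))| <= C * (oneDsqr y)^-1.
Proof.
have [||C C0 h] := @osc_decay2 (3 * j) (j%:R * (pi / 2)).
- by case: j => [|j]; rewrite ?mul0r ?sin0 ?mulr0// mulnS mul0r.
- by case: j => // j; apply/orP; right; lia.
exists (B (3 * j + 2) + C); first by rewrite addr_ge0.
move=> y s s1; rewrite ler_pdivlMr; last by rewrite (lt_le_trans ltr01)// oneDsqr_ge1.
rewrite /oneDsqr mulrDr mulr1 lerD//.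
  exact: osc_bound.
by rewrite mulrC -(ger0_norm (sqr_ge0 y)) -normrM h.
Qed.

(* [G y = osc 2 y 0 0] solves [G' = - y / 2 * G] by [osc_parts]. *)
Lemma osc_gauss y : osc 2 y 0 0 = Num.sqrt pi / 6 * expR (- (y / 2) ^+ 2).
Proof.
have s0 : `|0 : R| <= 1 by rewrite normr0.
pose G y := osc 2 y 0 0.
have dG t : is_derive t (1 : R) G (- (t / 2) * G t).
  apply: is_derive_eq; first exact: is_derive_osc.
  (* At [n = 0] and [s = 0] only the moment 5 survives on the right, and moving its shift from
     [- pi / 2] to [pi / 2] changes the sign. *)
  have := @osc_parts 0 t 0 0 s0; rewrite !(mul0r, mulr0, subr0, oppr0, sin0, add0r) /=.
  rewrite (_ : osc (0 + 5) t 0 (- (pi / 2)) = - osc (2 + 3) t 0 (0 + pi / 2)).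
    rewrite /G add0n !add0r; lra.
  have -> : - osc (2 + 3) t 0 (0 + pi / 2) =
      \int[mu]_(z in `[0, +oo[) (-1 * osc_fun (2 + 3) t 0 (0 + pi / 2) z).
    by rewrite RintegralZl ?mulN1r//; exact: integrable_osc_fun.
  apply: eq_Rintegral => z _; rewrite /osc_fun /phase add0r cosDpihalf.
  by rewrite cosBpihalf; ring.
have dH t : is_derive t (1 : R) (fun t => G t * expR ((t / 2) ^+ 2)) 0.
  have := dG t => ?.
  apply: is_derive_eq; rewrite /GRing.scale/=.
  by move: (expR _) => e; field.
have GH : G y * expR ((y / 2) ^+ 2) = G 0.
  rewrite (is_derive_0_is_cst y 0 dH)/=.
  by rewrite (_ : (0 / 2 : R) = 0) ?mul0r// expr0n expR0 mulr1.
have G0 : G 0 = Num.sqrt pi / 6.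
  rewrite /G /osc.
  (* Under [w = z ^+ 3] the half-line Gaussian integral becomes three times the integral of
     [z ^+ 2 * exp (- z ^+ 6)], which is [G 0]. *)
  have := @Rintegral_cube _ (@gauss_fun R) 1 ltr01 (@continuous_gauss_fun R).
  rewrite {1}/Rintegral integral0y_gauss/=.
  rewrite (_ : \int[mu]_(x in `[0, +oo[) (gauss_fun (1 * x ^+ 3) * (3 * 1 * x ^+ 2)) =
    3 * \int[mu]_(x in `[0, +oo[) osc_fun 2 0 0 0 x).
    move: (Rintegral _ _ _) (Num.sqrt pi) => I S; lra.
  rewrite -RintegralZl//; last exact: integrable_osc_fun.
  apply: eq_Rintegral => x _; rewrite /osc_fun /amplitude /phase /gauss_fun.
  rewrite !mul0r !addr0 cos0 mul1r -exprM; ring.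
by rewrite -/(G y) expRN -G0 -GH mulfK// gt_eqF// expR_gt0.
Qed.

End oscillatory.

(** * The rescaled kernel *)

Section scaled_kernel.
Context {R : realType}.
Local Notation mu := (@lebesgue_measure R).
Local Notation RR := (measurableTypeR R).

(* With [t = tau ^+ 6], [xi = (zeta / tau) ^+ 3] and [z = x / tau ^+ 3], all the
   fractional powers in [K_hat] disappear: [skernel j tau z] is, up to the
   normalisation of [semigroupE], [tau ^+ (3 * j.+1)] times the [j]-th space
   derivative of [kernelK] at time [tau ^+ 6]. The truncation
   only serves to make the bounds global in [tau]. *)
Definition skernel (j : nat) (tau z : R) : R :=
  3 / pi * osc coef_a coef_b (3 * j + 2) z (Num.min (tau ^+ 2) 1) (j%:R * (pi / 2)).

Lemma normr_min_sqr_le1 (tau : R) : `|Num.min (tau ^+ 2) 1| <= 1.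
Proof. by rewrite ger0_norm ?ge_min ?lexx ?orbT// le_min sqr_ge0 ler01. Qed.

Lemma min_sqr_lipschitz (t s : R) :
  `|Num.min (t ^+ 2) 1 - Num.min (s ^+ 2) 1| <= 2 * `|t - s|.
Proof.
rewrite -(real_normK (num_real t)) -(real_normK (num_real s)).
apply: (@le_trans _ _ (2 * `| `|t| - `|s| |)); last first.
  by rewrite ler_wpM2l// ler_dist_dist.
move: `|t| `|s| (normr_ge0 t) (normr_ge0 s) => {}t {}s t0 s0.
wlog ts : t s t0 s0 / t <= s.
  move=> H; case: (leP t s) => [|/ltW] ts; first exact: H.
  by rewrite distrC [X in _ * X]distrC H.
have t2s2 : t ^+ 2 <= s ^+ 2 by rewrite lerXn2r.
rewrite distrC [X in _ * X]distrC (ger0_norm (_ : 0 <= s - t)) ?subr_ge0//.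
rewrite ger0_norm; last by rewrite subr_ge0 le_min !ge_min t2s2 lexx orbT.
have [t1|t1] := leP 1 t.
  rewrite !min_r ?expr_ge1 ?(le_trans t1)//; lra.
rewrite (min_l (_ : t ^+ 2 <= 1)) ?expr_le1 ?(ltW t1)//.
have [s1|s1] := leP 1 s.
  have h : Num.min (s ^+ 2) 1 <= 1 by rewrite ge_min lexx orbT.
  nra.
have h : Num.min (s ^+ 2) 1 <= s ^+ 2 by rewrite ge_min lexx.
nra.
Qed.

Lemma skernel_decay j : exists2 C, 0 <= C &
  forall tau z, `|skernel j tau z| <= C * (oneDsqr z)^-1.
Proof.
have [C C0 h] := @osc_decay R coef_a coef_b j.
exists (3 / pi * C); first by rewrite mulr_ge0// divr_ge0// pi_ge0.
move=> tau z; rewrite normrM ger0_norm ?divr_ge0 ?pi_ge0//.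
rewrite -[leRHS]mulrA ler_wpM2l//; first by rewrite divr_ge0 ?pi_ge0.
by apply: h; exact: normr_min_sqr_le1.
Qed.

Lemma is_derive_skernel j (tau z : R) :
  is_derive z (1 : R) (skernel j tau) (skernel j.+1 tau z).
Proof.
have := @is_derive_osc R coef_a coef_b (3 * j + 2) z _ (j%:R * (pi / 2))
  (normr_min_sqr_le1 tau).
rewrite (_ : (3 * j + 2 + 3)%N = (3 * j.+1 + 2)%N); last by lia.
rewrite (_ : j%:R * (pi / 2) + pi / 2 = j.+1%:R * (pi / 2)); last first.
  by move: (pi / 2) => p; rewrite -natr1 mulrDl mul1r.
by move=> h; exact: (is_deriveZ _ h).
Qed.

Lemma continuous_skernel j tau : continuous (skernel j tau).
Proof.
move=> z; apply/differentiable_continuous/derivable1_diffP.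
by have [] := is_derive_skernel j tau z.
Qed.

Lemma skernel_lipschitz j : exists2 C, 0 <= C &
  forall tau tau' z, `|skernel j tau z - skernel j tau' z| <= C * `|tau - tau'|.
Proof.
pose C : R := (2 * `|coef_a| + `|coef_b|) * amp_bound coef_a (3 * j + 2 + 4) * (pi / 2).
have C0 : 0 <= C.
  by rewrite !mulr_ge0// ?invr_ge0 ?pi_ge0 ?amp_bound_ge0// addr_ge0// mulr_ge0.
have p0 : 0 <= 3 / pi :> R by rewrite divr_ge0 ?pi_ge0.
exists (3 / pi * C * 2); first by rewrite mulr_ge0// mulr_ge0.
move=> tau tau' z; rewrite -mulrBr normrM ger0_norm//.
rewrite -2!(mulrA (3 / pi)) ler_wpM2l//.
apply: (le_trans (osc_lipschitz _ _ _ _ _ (normr_min_sqr_le1 _) (normr_min_sqr_le1 _))).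
by rewrite -/C -mulrA ler_wpM2l// min_sqr_lipschitz.
Qed.

(** At [tau = 0] the rescaled kernel is the heat kernel at time 1. Its mass makes the formula for
    [E] return the function itself at time 0. *)
Lemma skernel_integral1 : \int[mu]_z skernel 0 0 z = 1.
Proof.
have E z : skernel 0 0 z = (2 * Num.sqrt pi)^-1 * gauss_fun (0 + 2^-1 * z).
  rewrite /skernel muln0 add0n expr0n/= min_l// mul0r osc_gauss /gauss_fun add0r.
  rewrite [_ * z]mulrC; move: (expR _) => e.
  have sp : (Num.sqrt pi : R) != 0 by rewrite gt_eqF// sqrtr_gt0 pi_gt0.
  rewrite -[X in 3 / X](@sqr_sqrtr _ (pi : R)) ?pi_ge0//.
  by move: (Num.sqrt _) sp => s s0; field.
have sp : 0 < Num.sqrt pi :> R by rewrite sqrtr_gt0 pi_gt0.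
have h2 : 0 < 2^-1 :> R by rewrite invr_gt0.
have := @Rintegral_affine R (@gauss_fun R) 0 2^-1 h2 (@continuous_gauss_fun R).
rewrite {1}/Rintegral integralT_gauss/= => h.
have cg : continuous (fun z : R => gauss_fun (0 + 2^-1 * z)).
  move=> z; apply: continuous_comp; last exact: continuous_gauss_fun.
  by apply: cvgD; [exact: cvg_cst|apply: cvgM; [exact: cvg_cst|exact: cvg_id]].
have ig : mu.-integrable [set: RR] (EFin \o (fun z : R => gauss_fun (0 + 2^-1 * z))).
  have [C C0 hC] := skernel_decay 0.
  apply: (@integrable_dominated _ _ _ (fun z => 2 * Num.sqrt pi * (C * (oneDsqr z)^-1))) => //.
  - exact: continuous_measurable_fun.
  - have := integrableZl measurableT (2 * Num.sqrt pi)
      (integrableZl measurableT C (@integrable_oneDsqrV R)).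
    by [].
  - move=> z _; rewrite -ler_pdivrMl ?mulr_gt0//.
    by rewrite -[X in X * _]ger0_norm -?normrM -?E ?hC// invr_ge0 mulr_ge0// ltW.
under eq_Rintegral do rewrite E.
rewrite RintegralZl//.
move: h; rewrite RintegralZr// => h.
apply: (@mulfI _ (Num.sqrt pi)); first by rewrite gt_eqF.
move: h; move: (Rintegral _ _ _) => I h.
have -> : I = 2 * Num.sqrt pi by lra.
by move: (Num.sqrt _) sp => q sp; field; rewrite gt_eqF.
Qed.

Lemma continuous_normr_powR (p : R) : 1 <= p -> continuous (fun x : R => `|x| `^ p).
Proof.
move=> p1 x; have [->|x0] := eqVneq x 0.
  apply/cvgrPdist_lt => e e0; near=> y.
  rewrite normr0 powR0 ?sub0r ?normrN; last by rewrite gt_eqF// (lt_le_trans ltr01).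
  have [->|y0] := eqVneq y 0.
    by rewrite normr0 powR0 ?normr0//; rewrite gt_eqF// (lt_le_trans ltr01).
  have y1 : `|y| < 1.
    rewrite -(normrN y) -sub0r; near: y.
    by apply: (@cvgr_dist_lt _ _ _ _ _ id 0 cvg_id).
  have ye : `|y| < e.
    rewrite -(normrN y) -sub0r; near: y.
    by apply: (@cvgr_dist_lt _ _ _ _ _ id 0 cvg_id).
  rewrite ger0_norm ?powR_ge0// (le_lt_trans _ ye)// ge1r_powR//.
  by rewrite normr_gt0 y0 ltW.
apply: (@continuous_comp _ _ _ (fun x : R => `|x|) (fun y => y `^ p)).
  exact: norm_continuous.
apply/differentiable_continuous/derivable1_diffP.
by apply: derivable_powR; rewrite in_itv/= andbT normr_gt0.
Unshelve. all: end_near. Qed.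

(** Because the cosine is even, the sign of [xi] is absorbed by writing the phase in [|xi|]; the
    integrand is then visibly even and folds onto the half-line. *)
Lemma Re_integrand (x t xi : R) :
  complex.Re (cexp ('i%C * (x * xi)%:C%C) * K_hat t xi) =
  expR (- t * (xi ^+ 2 - `|xi| `^ (4 / 3) * coef_a)) *
  cos (x * `|xi| + t * `|xi| `^ (4 / 3) * coef_b).
Proof.
transitivity (expR (- t * (xi ^+ 2 - `|xi| `^ (4 / 3) * coef_a)) *
    cos (x * xi + t * `|xi| `^ (4 / 3) * coef_b * Num.sg xi)).
  rewrite /K_hat /cexp /= !(mul0r, mulr0, mul1r, subr0, sub0r, oppr0, addr0, add0r).
  rewrite expR0 cosD !(mul0r, mulr0, mul1r, addr0, subr0) mulrNN !mulrA; ring.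
congr (_ * _); have [xi0|xi0|->] := ltgtP xi 0.
- rewrite ltr0_sg// ltr0_norm// -[LHS]cosN; congr cos; ring.
- by rewrite gtr0_sg// gtr0_norm// mulr1.
- by rewrite normr0 powR0 ?sgr0 ?mulr0 ?mul0r//; rewrite gt_eqF//; lra.
Qed.

(** The 6 is a 2 from evenness times a 3 from the cubic Jacobian. For [tau <= 1] the truncated
    [Num.min (tau ^+ 2) 1] is [tau ^+ 2]. *)
Lemma kernelKE (x tau : R) : 0 < tau <= 1 ->
  kernelK x (tau ^+ 6) = (Num.sqrt (2 * pi))^-1 *
    (6 / tau ^+ 3 * osc coef_a coef_b 2 (x / tau ^+ 3) (Num.min (tau ^+ 2) 1) 0).
Proof.
move=> /andP[t0 t1].
pose G (xi : R) := expR (- tau ^+ 6 * (xi ^+ 2 - `|xi| `^ (4 / 3) * coef_a)) *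
  cos (x * `|xi| + tau ^+ 6 * `|xi| `^ (4 / 3) * coef_b).
have cp : continuous (fun xi : R => `|xi| `^ (4 / 3)).
  by apply: continuous_normr_powR; lra.
have cG : continuous G.
  have ccst (c : R) : continuous (fun _ : R => c) by move=> z; exact: cvg_cst.
  move=> z; apply: cvgM.
    apply: continuous_cvg; first exact: continuous_expR.
    apply: cvgM; first exact: ccst.
    by apply: cvgB; [exact: exprn_continuous|apply: cvgM; [exact: cp|exact: ccst]].
  apply: continuous_cvg; first exact: continuous_cos.
  apply: cvgD.
    by apply: cvgM; [exact: ccst|exact: norm_continuous].
  by apply: cvgM; [apply: cvgM; [exact: ccst|exact: cp]|exact: ccst].
have GN xi : G (- xi) = G xi by rewrite /G sqrrN normrN.
have ti : 0 < tau ^- 3 by rewrite invr_gt0 exprn_gt0.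
transitivity ((Num.sqrt (2 * pi))^-1 * \int[mu]_xi G xi).
  have ReZ (c : R) (z : R[i]) : complex.Re (c%:C%C * z) = c * complex.Re z.
    by case: z => u v /=; rewrite mul0r subr0.
  rewrite /kernelK /K_complex /inv_fourier ReZ; congr (_ * _).
  by apply: eq_Rintegral => xi _; rewrite Re_integrand.
rewrite Rintegral_even// (Rintegral_cube ti cG) /osc; congr (_ * _).
have s1 := normr_min_sqr_le1 tau.
rewrite (_ : 6 / tau ^+ 3 = 2 * (3 * tau ^- 3)); last by rewrite mulrA -natrM.
rewrite -[RHS]mulrA; congr (2 * _).
rewrite -RintegralZl//; last exact: integrable_osc_fun.
apply: eq_Rintegral => z; rewrite inE/= in_itv/= andbT => z0.
have t30 : tau != 0 by rewrite gt_eqF.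
have zt : 0 <= z / tau by rewrite divr_ge0// ltW.
have n1 : `|tau ^- 3 * z ^+ 3| = (z / tau) ^+ 3.
  by rewrite mulrC -expr_div_n ger0_norm// exprn_ge0.
have p1 : ((z / tau) ^+ 3) `^ (4 / 3) = (z / tau) ^+ 4.
  rewrite -[(z / tau) ^+ 3]powR_mulrn// -powRrM.
  by rewrite (_ : 3%:R * (4 / 3) = 4%:R) ?powR_mulrn//; field.
rewrite /G /osc_fun /amplitude /phase n1 p1.
have ht : Num.min (tau ^+ 2) 1 = tau ^+ 2 by rewrite min_l// expr_le1// ltW.
rewrite ht.
rewrite (_ : - tau ^+ 6 * ((tau ^- 3 * z ^+ 3) ^+ 2 - (z / tau) ^+ 4 * coef_a) =
   - z ^+ 6 + tau ^+ 2 * coef_a * z ^+ 4); last first.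
  by move: coef_a => ?; field.
rewrite (_ : x * (z / tau) ^+ 3 + tau ^+ 6 * (z / tau) ^+ 4 * coef_b =
   x / tau ^+ 3 * z ^+ 3 + tau ^+ 2 * coef_b * z ^+ 4 + 0); last first.
  by move: coef_b => ?; field.
move: (expR _) (cos _) => e c; ring.
Qed.

Lemma semigroupE_skernel (tau x : R) (phi : R -> R) (B : R) : 0 < tau <= 1 ->
  continuous phi -> (forall y, `|phi y| <= B) ->
  semigroupE (tau ^+ 6) phi x = \int[mu]_z (skernel 0 tau z * phi (x - tau ^+ 3 * z)).
Proof.
move=> t01 cphi hB; have /andP[t0 t1] := t01.
have t3 : 0 < tau ^+ 3 by rewrite exprn_gt0.
rewrite /semigroupE exprn_gt0//.
pose c : R := (Num.sqrt (2 * pi))^-1 * (6 / tau ^+ 3) * (pi / 3).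
have p0 : pi != 0 :> R by rewrite gt_eqF// pi_gt0.
have KE y : kernelK y (tau ^+ 6) = c * skernel 0 tau (y / tau ^+ 3).
  rewrite kernelKE// /skernel muln0 add0n mul0r /c.
  move: (osc _ _ _ _ _ _) => o.
  move: (_^-1) => q; move: (pi : R) p0 => p p0; field.
  by rewrite p0 gt_eqF.
have cK : continuous (fun y => kernelK (x - y) (tau ^+ 6) * phi y).
  have -> : (fun y => kernelK (x - y) (tau ^+ 6) * phi y) =
      (fun y => c * skernel 0 tau ((x - y) / tau ^+ 3) * phi y).
    by apply/funext => y; rewrite KE.
  move=> y; apply: cvgM; last exact: cphi.
  apply: cvgM; first exact: cvg_cst.
  apply: (@continuous_comp _ _ _ (fun y => (x - y) / tau ^+ 3) (skernel 0 tau));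
    last exact: continuous_skernel.
  by apply: cvgM; [apply: cvgB; [exact: cvg_cst|exact: cvg_id]|exact: cvg_cst].
rewrite /convolution (@Rintegral_reflect_affine _ _ x (tau ^+ 3))//.
(* Two factors [(2 pi) ^ (-1/2)], from the inverse transform and from [semigroupE], turn 6 into the
   [3 / pi] of [skernel]; the Jacobian [tau ^+ 3] cancels the rescaling. *)
have c1 : (Num.sqrt (2 * pi))^-1 * c * tau ^+ 3 = 1.
  have p2 : 0 <= 2 * pi :> R by rewrite mulr_ge0 ?pi_ge0.
  have s0 : Num.sqrt (2 * pi) != 0 :> R by rewrite gt_eqF// sqrtr_gt0 mulr_gt0 ?pi_gt0.
  have -> : c = (Num.sqrt (2 * pi))^-1 * (6 / tau ^+ 3) * ((Num.sqrt (2 * pi)) ^+ 2 / 6).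
    by rewrite sqr_sqrtr// /c; move: (Num.sqrt _)^-1 => q; field; rewrite gt_eqF.
  by move: (Num.sqrt _) s0 => q s0; field; rewrite s0 gt_eqF.
have iI : mu.-integrable [set: RR] (EFin \o (fun z => skernel 0 tau z * phi (x - tau ^+ 3 * z))).
  have [C C0 hC] := skernel_decay 0.
  apply: (@integrable_dominated _ _ _ (fun z => B * (C * (oneDsqr z)^-1))) => //.
  - apply: continuous_measurable_fun => z; apply: cvgM; first exact: continuous_skernel.
    apply: continuous_comp; last exact: cphi.
    by apply: cvgB; [exact: cvg_cst|apply: cvgM; [exact: cvg_cst|exact: cvg_id]].
  - exact: (integrableZl measurableT B (integrableZl measurableT C (@integrable_oneDsqrV R))).
  - by move=> z _; rewrite normrM mulrC ler_pM.
transitivity ((Num.sqrt (2 * pi))^-1 *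
    \int[mu]_z ((c * tau ^+ 3) * (skernel 0 tau z * phi (x - tau ^+ 3 * z)))); last first.
  by rewrite RintegralZl// mulrA (mulrA _ c) c1 mul1r.
congr (_ * _); apply: eq_Rintegral => z _.
rewrite KE (_ : (x - (x - tau ^+ 3 * z)) / tau ^+ 3 = z).
  by move: (skernel _ _ _) (phi _) => k p; ring.
by field; rewrite gt_eqF.
Qed.

End scaled_kernel.

(** * Bounded uniformly continuous functions of time and space *)

Section uniform_continuity.
Context {R : realType}.
Implicit Types (f : R -> R) (g : R -> R -> R).

(** Time ranges over the whole line, so no interval has to be carried along: functions on [[0, T]]
    enter through [clamp], and functions of [x] alone as constant in time. *)
Definition BUC2 g : Prop := (exists B : R, forall t x, `|g t x| <= B) /\
  forall e : R, 0 < e -> exists2 d : R, 0 < d & forall t t' x x',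
    `|t - t'| < d -> `|x - x'| < d -> `|g t x - g t' x'| <= e.

Lemma BUC2_continuous g (s y : R -> R) : BUC2 g -> continuous s -> continuous y ->
  continuous (fun z => g (s z) (y z)).
Proof.
move=> [_ ug] cs cy z; apply/cvgrPdist_le => e e0.
have [d d0 h] := ug e e0.
have /cvgrPdist_lt/(_ _ d0) hs := cs z.
have /cvgrPdist_lt/(_ _ d0) hy := cy z.
by near=> z'; apply: h; near: z'.
Unshelve. all: end_near. Qed.

Lemma is_derive_le f (x l : R) :
  (forall e : R, 0 < e -> exists2 d : R, 0 < d &
    forall h, `|h| < d -> `|f (x + h) - f x - h * l| <= e * `|h|) ->
  is_derive x (1 : R) f l.
Proof.
move=> H.
have c : h^-1 *: ((f \o shift x) (h *: (1 : R)) - f x) @[h --> (0 : R)^'] --> l.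
  apply/cvgrPdist_le => e e0; have [d d0 hd] := H e e0.
  near=> h.
  have h0 : h != 0 by near: h; exact: nbhs_dnbhs_neq.
  have hh : `|h| < d.
    near: h; apply: dnbhs0_lt; exact: d0.
  have := hd _ hh; rewrite /= /GRing.scale/= mulr1 (addrC h).
  rewrite -(@ler_pM2l _ `|h|^-1) ?invr_gt0 ?normr_gt0//.
  rewrite mulrCA mulVf ?normr_eq0// mulr1 -normfV -normrM distrC.
  by rewrite (_ : h^-1 * (f (x + h) - f x) - l = h^-1 * (f (x + h) - f x - h * l)) ?normrM//; field.
apply: DeriveDef; first by apply/cvg_ex; exists l.
by rewrite /derive; apply: cvg_lim.
Unshelve. all: end_near. Qed.

Lemma normr_exprB_le (n : nat) (M x y : R) : `|x| <= M -> `|y| <= M ->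
  `|x ^+ n - y ^+ n| <= n%:R * M ^+ n.-1 * `|x - y|.
Proof.
move=> xM yM; rewrite subrXX normrM mulrC ler_wpM2r//.
apply: (le_trans (ler_norm_sum _ _ _)).
have M0 : 0 <= M by rewrite (le_trans _ xM).
rewrite mulr_natl (_ : M ^+ n.-1 *+ n = \sum_(i < n) M ^+ n.-1); last first.
  by rewrite sumr_const card_ord.
apply: ler_sum => i _; rewrite normrM !normrX.
rewrite (@le_trans _ _ (M ^+ (n.-1 - i) * M ^+ i))//.
  by rewrite ler_pM ?exprn_ge0// lerXn2r ?nnegrE.
by rewrite -exprD subnK// -ltnS prednK// (leq_ltn_trans _ (ltn_ord i)).
Qed.

End uniform_continuity.

(** * The semigroup *)

Section smoothing.
Context {R : realType}.
Local Notation mu := (@lebesgue_measure R).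
Local Notation RR := (measurableTypeR R).
Implicit Types (F G phi : R -> R) (g : R -> R -> R).

(** For [j = 0] and [0 <= tau <= 1] this is [E(tau^6) g(t - tau^6)] at [x], the Duhamel integrand at
    time [t - tau^6]. For [tau > 0], index [j] is [tau^(3j)] times the [j]-th [x]-derivative of
    index 0, a quantity that stays bounded as [tau] tends to 0. *)
Definition smooth (j : nat) g (tau t x : R) : R :=
  \int[mu]_z (skernel j tau z * g (t - tau ^+ 6) (x - tau ^+ 3 * z)).

Lemma skernel_integrable j tau F D : continuous F -> (forall z, `|F z| <= D) ->
  mu.-integrable [set: RR] (EFin \o (fun z => skernel j tau z * F z)).
Proof.
move=> cF hF; have [C C0 hC] := @skernel_decay R j.
apply: (@integrable_dominated _ _ _ (fun z => D * (C * (oneDsqr z)^-1))) => //.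
- apply: continuous_measurable_fun => z.
  by apply: cvgM; [exact: continuous_skernel|exact: cF].
- exact: (integrableZl measurableT D (integrableZl measurableT C (@integrable_oneDsqrV R))).
- by move=> z _; rewrite normrM mulrC ler_pM.
Qed.

Lemma skernel_bound j : exists2 K : R, 0 <= K & forall tau F D, continuous F ->
  (forall z, `|F z| <= D) -> `|\int[mu]_z (skernel j tau z * F z)| <= K * D.
Proof.
have [C C0 hC] := @skernel_decay R j.
have iw := @integrable_oneDsqrV R.
have w0 : 0 <= \int[mu]_z (oneDsqr z)^-1.
  by apply: Rintegral_ge0 => z _; rewrite invr_ge0 (le_trans ler01)// oneDsqr_ge1.
exists (C * \int[mu]_z (oneDsqr z)^-1); first by rewrite mulr_ge0.
move=> tau F D cF hF.
rewrite [leRHS]mulrAC -RintegralZl//.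
apply: normr_Rintegral_dominated => //.
- apply: continuous_measurable_fun => z.
  by apply: cvgM; [exact: continuous_skernel|exact: cF].
- exact: (integrableZl measurableT (C * D) iw).
- move=> z _; rewrite normrM (_ : C * D * _ = (C * (oneDsqr z)^-1) * D); last by ring.
  by rewrite ler_pM.
Qed.

Lemma continuous_smooth_arg g tau t x : BUC2 g ->
  continuous (fun z => g (t - tau ^+ 6) (x - tau ^+ 3 * z)).
Proof.
move=> bg; apply: (@BUC2_continuous _ g (fun=> t - tau ^+ 6) (fun z => x - tau ^+ 3 * z)) => //.
  by move=> z; exact: cvg_cst.
move=> z; apply: cvgB; first exact: cvg_cst.
by apply: cvgM; [exact: cvg_cst|exact: cvg_id].
Qed.

Lemma smooth_integrable j g tau t x : BUC2 g ->
  mu.-integrable [set: RR]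
    (EFin \o (fun z => skernel j tau z * g (t - tau ^+ 6) (x - tau ^+ 3 * z))).
Proof.
move=> bg; have [[B hB] _] := bg.
apply: (@skernel_integrable _ _ _ B); last by move=> z; exact: hB.
exact: continuous_smooth_arg.
Qed.

Lemma smooth_bound j : exists2 K : R, 0 <= K & forall g tau t x D, BUC2 g ->
  (forall y, `|g (t - tau ^+ 6) y| <= D) -> `|smooth j g tau t x| <= K * D.
Proof.
have [K K0 h] := skernel_bound j; exists K => // g tau t x D bg hD.
by apply: h => //; exact: continuous_smooth_arg.
Qed.

Lemma smooth_diff j : exists2 K : R, 0 <= K & forall g g' tau t t' x x' D,
  BUC2 g -> BUC2 g' ->
  (forall z, `|g (t - tau ^+ 6) (x - z) - g' (t' - tau ^+ 6) (x' - z)| <= D) ->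
  `|smooth j g tau t x - smooth j g' tau t' x'| <= K * D.
Proof.
have [K K0 h] := skernel_bound j; exists K => // g g' tau t t' x x' D bg bg' hD.
rewrite /smooth -RintegralB//; [|exact: smooth_integrable..].
rewrite (_ : (fun _ => _) = fun z => skernel j tau z *
   (g (t - tau ^+ 6) (x - tau ^+ 3 * z) - g' (t' - tau ^+ 6) (x' - tau ^+ 3 * z))).
  apply: h; last by move=> z; exact: hD.
  by move=> z; apply: cvgB; exact: continuous_smooth_arg.
by apply/funext => z; rewrite mulrBr.
Qed.

(** The tail in [z] is small uniformly, by the decay of the kernel. For [|z| <= N] the kernel is
    Lipschitz in [tau], and the arguments of [g] move little because [tau ^+ 3 * z] does. *)
Lemma smooth_ucont j g (M : R) : BUC2 g -> 0 <= M -> forall e : R, 0 < e ->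
  exists2 d : R, 0 < d & forall tau tau' t t' x x', `|tau| <= M -> `|tau'| <= M ->
    `|tau - tau'| < d -> `|t - t'| < d -> `|x - x'| < d ->
    `|smooth j g tau t x - smooth j g tau' t' x'| <= e.
Proof.
move=> bg M0 e e0.
have [[B hB] ug] := bg.
have B0 : 0 <= B by rewrite (le_trans _ (hB 0 0)).
have [C C0 hC] := @skernel_decay R j.
have [L L0 hL] := @skernel_lipschitz R j.
have iw := @integrable_oneDsqrV R.
have w0 z : 0 <= (oneDsqr z)^-1 :> R by rewrite invr_ge0 (le_trans ler01)// oneDsqr_ge1.
set Iw := \int[mu]_z (oneDsqr z : R)^-1.
have Iw0 : 0 <= Iw by exact: Rintegral_ge0.
have CB0 : 0 <= 4 * C * B by rewrite !mulr_ge0.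
have e20 : 0 < e / 2 by rewrite divr_gt0.
have [N [N0 hN]] := Rintegral_split e20 CB0 iw w0.
pose eta := e / (2 * (Iw + 1)).
have Iw1 : 0 < Iw + 1 by rewrite ltr_wpDl.
have eta0 : 0 < eta by rewrite divr_gt0// mulr_gt0.
have C10 : 0 < C + 1 by rewrite ltr_wpDl.
have C20 : 0 < eta / (2 * (C + 1)) by rewrite divr_gt0// mulr_gt0.
have [d1 d10 hd1] := ug _ C20.
(* [Q] collects the Lipschitz constants in [tau]: of the kernel, relative to the weight on
   [|z| <= N]; of [tau ^+ 6]; and of [tau ^+ 3 * z]. *)
pose Q := L * B * oneDsqr N + 6 * M ^+ 5 + 3 * M ^+ 2 * N + 1.
have oN : 1 <= oneDsqr N by exact: oneDsqr_ge1.
have Q1 : 0 <= L * B * oneDsqr N by rewrite !mulr_ge0// (le_trans ler01).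
have Q2 : 0 <= 6 * M ^+ 5 by rewrite mulr_ge0// exprn_ge0.
have Q3 : 0 <= 3 * M ^+ 2 * N by rewrite !mulr_ge0 ?exprn_ge0// ltW.
have Q0 : 0 < Q by rewrite ltr_wpDl// !addr_ge0.
have [QQ1 QQ2 QQ3] : [/\ L * B * oneDsqr N <= Q, 6 * M ^+ 5 <= Q & 3 * M ^+ 2 * N <= Q].
  rewrite /Q; move: Q1 Q2 Q3; move: (L * B * _) (6 * _) (3 * _ * _) => q1 q2 q3.
  by move=> Q1 Q2 Q3; split; lra.
pose d := Num.min (d1 / 2) (Num.min (d1 / 2) (eta / 2) / Q).
have d120 : 0 < d1 / 2 by rewrite divr_gt0.
have eta20 : 0 < eta / 2 by rewrite divr_gt0.
have d0 : 0 < d by rewrite lt_min d120/= divr_gt0// lt_min d120.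
exists d => // tau tau' t t' x x' tM tM' htau ht hx.
have hd1' : d <= d1 / 2 by rewrite ge_min lexx.
have dQ1 : d * Q <= d1 / 2.
  by rewrite -ler_pdivlMr// ge_min ler_pM2r ?invr_gt0// ge_min lexx orbT.
have dQ2 : d * Q <= eta / 2.
  by rewrite -ler_pdivlMr// ge_min ler_pM2r ?invr_gt0// [X in _ || X]ge_min lexx !orbT.
rewrite /smooth -RintegralB//; [|exact: smooth_integrable..].
set h := (fun z => _ - _).
have mh : measurable_fun [set: RR] h.
  apply: continuous_measurable_fun => z; apply: cvgB; apply: cvgM;
    [exact: continuous_skernel|exact: continuous_smooth_arg|
     exact: continuous_skernel|exact: continuous_smooth_arg].
apply: (le_trans (hN h eta mh (ltW eta0) _ _)); last first.
  rewrite -/Iw [leRHS](splitr e) lerD2r /eta.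
  rewrite invfM mulrA -[leRHS]mulr1 -mulrA ler_wpM2l ?divr_ge0// ?ltW//.
  by rewrite ltr_pdivrMl// mulr1 ltrDl.
- move=> z zN; rewrite /h.
  have -> : skernel j tau z * g (t - tau ^+ 6) (x - tau ^+ 3 * z) -
    skernel j tau' z * g (t' - tau' ^+ 6) (x' - tau' ^+ 3 * z) =
    (skernel j tau z - skernel j tau' z) * g (t - tau ^+ 6) (x - tau ^+ 3 * z) +
    skernel j tau' z * (g (t - tau ^+ 6) (x - tau ^+ 3 * z) -
      g (t' - tau' ^+ 6) (x' - tau' ^+ 3 * z)) by ring.
  (* The Lipschitz bound on the kernel carries no weight; on [|z| <= N] a constant is at most
     [oneDsqr N] times the weight. *)
  have wN : (oneDsqr N)^-1 <= (oneDsqr z)^-1.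
    rewrite lef_pV2 ?posrE ?(lt_le_trans ltr01) ?oneDsqr_ge1//.
    rewrite /oneDsqr lerD2l -(real_normK (num_real z)) lerXn2r// nnegrE ltW//.
  have h1 : `|(skernel j tau z - skernel j tau' z) * g (t - tau ^+ 6) (x - tau ^+ 3 * z)|
      <= eta / 2 * (oneDsqr z)^-1.
    rewrite normrM.
    apply: (@le_trans _ _ ((L * d) * B)).
      rewrite ler_pM//.
      by rewrite (le_trans (hL _ _ _))// ler_wpM2l// ltW.
    apply: (@le_trans _ _ (eta / 2 * (oneDsqr N)^-1)); last by rewrite ler_wpM2l// ltW.
    rewrite ler_pdivlMr; last by rewrite (lt_le_trans ltr01).
    rewrite (le_trans _ dQ2)// (_ : L * d * B * _ = d * (L * B * oneDsqr N)); last by ring.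
    by apply: ler_wpM2l => //; exact: ltW.
  have h2 : `|g (t - tau ^+ 6) (x - tau ^+ 3 * z) - g (t' - tau' ^+ 6) (x' - tau' ^+ 3 * z)|
      <= eta / (2 * (C + 1)).
    apply: hd1.
      rewrite (_ : _ - _ = (t - t') - (tau ^+ 6 - tau' ^+ 6)); last by ring.
      rewrite (le_lt_trans (ler_normB _ _))// [ltRHS](splitr d1) ltr_leD//.
        by rewrite (lt_le_trans ht).
      rewrite (le_trans (normr_exprB_le 6 tM tM'))// (le_trans _ dQ1)//.
      by rewrite [leRHS]mulrC; apply: ler_pM => //; exact: ltW.
    rewrite (_ : _ - _ = (x - x') - (tau ^+ 3 - tau' ^+ 3) * z); last by ring.
    rewrite (le_lt_trans (ler_normB _ _))// [ltRHS](splitr d1) ltr_leD//.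
      by rewrite (lt_le_trans hx).
    rewrite normrM (le_trans (ler_pM _ _ (normr_exprB_le 3 tM tM') zN))//.
    rewrite (le_trans _ dQ1)// mulrAC.
    by rewrite [leRHS]mulrC; apply: ler_pM => //; exact: ltW.
  apply: (@le_trans _ _ (eta / 2 * (oneDsqr z)^-1 + (C * (oneDsqr z)^-1) * (eta / (2 * (C + 1))))).
    rewrite (le_trans (ler_normD _ _))// lerD//.
    by rewrite normrM ler_pM.
  rewrite (_ : eta / 2 * (oneDsqr z)^-1 + (C * (oneDsqr z)^-1) * (eta / (2 * (C + 1))) =
     (eta / 2 + eta / 2 * (C / (C + 1))) * (oneDsqr z)^-1); last first.
    by field; rewrite gt_eqF// gt_eqF// (lt_le_trans ltr01)// oneDsqr_ge1.
  rewrite ler_wpM2r// [leRHS](splitr eta) lerD2l ler_piMr//; first exact: ltW.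
  by rewrite ler_pdivrMr// mul1r lerDl.
- move=> z; rewrite /h.
  have X0 : 0 <= C * (oneDsqr z)^-1 * B by rewrite !mulr_ge0.
  apply: (@le_trans _ _ (C * (oneDsqr z)^-1 * B + C * (oneDsqr z)^-1 * B)).
    by rewrite (le_trans (ler_normB _ _))// lerD// normrM ler_pM.
  rewrite (_ : 4 * C * B * _ = 4 * (C * (oneDsqr z)^-1 * B)); last by ring.
  lra.
Qed.

Lemma continuous_smooth j g t x : BUC2 g -> continuous (fun tau => smooth j g tau t x).
Proof.
move=> bg tau; apply/cvgrPdist_le => e e0.
have M0 : 0 <= `|tau| + 1 by rewrite addr_ge0.
have [d d0 h] := smooth_ucont j bg M0 e0; near=> tau'.
have t1 : `|tau - tau'| < 1.
  by near: tau'; apply: (@cvgr_dist_lt _ _ _ _ _ id tau cvg_id).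
have t2 : `|tau - tau'| < d.
  by near: tau'; apply: (@cvgr_dist_lt _ _ _ _ _ id tau cvg_id).
apply: h; rewrite ?subrr ?normr0 ?lerDl//.
by rewrite -lerBlDl (le_trans (lerB_dist _ _))// distrC ltW.
Unshelve. all: end_near. Qed.

End smoothing.

(** * Space derivatives of the semigroup *)

Section smooth_derivative.
Context {R : realType}.
Local Notation mu := (@lebesgue_measure R).
Local Notation RR := (measurableTypeR R).
Implicit Types (phi : R -> R) (g : R -> R -> R).

Lemma oneDsqr_gt0 (z : R) : 0 < oneDsqr z.
Proof. by rewrite (lt_le_trans ltr01)// oneDsqr_ge1. Qed.

Lemma oneDsqrV_shift (s z : R) : `|s - z| <= 1 -> (oneDsqr s)^-1 <= 3 * (oneDsqr z)^-1.
Proof.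
move=> sz; rewrite ler_pdivlMr ?oneDsqr_gt0// ler_pdivrMl ?oneDsqr_gt0//.
have h : (s - z) ^+ 2 <= 1.
  by rewrite -(real_normK (num_real _)) expr_le1.
rewrite /oneDsqr.
(* Replacing the slack 2 by [2 * (s - z) ^+ 2] leaves [(2 * s - z) ^+ 2 + s ^+ 2 >= 0]. *)
have := sqr_ge0 (2 * s - z); nra.
Qed.

(** Moving the argument by at most 1 changes the weight by a bounded factor, so the quadratic
    remainder keeps an integrable weight and a constant independent of [tau]. *)
Lemma skernel_Taylor j : exists2 C : R, 0 <= C & forall tau z eta : R, `|eta| <= 1 ->
  `|skernel j tau (z + eta) - skernel j tau z - eta * skernel j.+1 tau z| <=
  C * (oneDsqr z)^-1 * eta ^+ 2.
Proof.
have [C C0 hC] := @skernel_decay R j.+2.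
exists (C * 3); first by rewrite mulr_ge0.
move=> tau z eta eta1.
rewrite -(real_normK (num_real eta)) expr2 [leRHS]mulrA.
apply: (Taylor1_bound (is_derive_skernel j tau)) => s hs.
have := @MVT_bound _ _ _ z (s - z) (C * 3 * (oneDsqr z)^-1) (is_derive_skernel j.+1 tau).
rewrite addrCA subrr addr0 => h.
apply: (le_trans (h _)).
  move=> r hr; apply: (le_trans (hC _ _)); rewrite -mulrA ler_wpM2l//.
  by apply: oneDsqrV_shift; rewrite (le_trans hr)// (le_trans hs).
by rewrite ler_wpM2l// !mulr_ge0// invr_ge0 ltW// oneDsqr_gt0.
Qed.

(* Translation invariance moves the increment [h] from the function to the kernel. *)
Lemma is_derive_smooth j g tau t x : BUC2 g -> 0 < tau ->
  is_derive x (1 : R) (fun x => tau ^+ 3 * smooth j g tau t x) (smooth j.+1 g tau t x).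
Proof.
move=> bg tau0; have [[B hB] _] := bg.
have B0 : 0 <= B by rewrite (le_trans _ (hB 0 0)).
have [C C0 hC] := skernel_Taylor j.
have [C' C'0 hC'] := @skernel_decay R j.
have iw := @integrable_oneDsqrV R.
have w0 z : 0 <= (oneDsqr z)^-1 :> R by rewrite invr_ge0 ltW// oneDsqr_gt0.
set Iw := \int[mu]_z (oneDsqr z : R)^-1.
have Iw0 : 0 <= Iw by exact: Rintegral_ge0.
have t3 : 0 < tau ^+ 3 by rewrite exprn_gt0.
have t3n : tau ^+ 3 != 0 by rewrite gt_eqF.
apply: is_derive_le => e e0.
(* The integrated Taylor remainder is at most [C * B * Iw * h ^+ 2 / tau ^+ 3]. The radius makes
   this at most [e * |h|], and its bound [tau ^+ 3] keeps the kernel increment within 1. *)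
pose Q := C * B * Iw + 1.
have Q0 : 0 < Q by rewrite ltr_wpDl// !mulr_ge0.
have d0 : 0 < Num.min (tau ^+ 3) (e * tau ^+ 3 / Q).
  by rewrite lt_min t3/= divr_gt0// mulr_gt0.
exists (Num.min (tau ^+ 3) (e * tau ^+ 3 / Q)) => // h.
rewrite lt_min => /andP[h1 h2].
pose eta := h / tau ^+ 3.
have eta1 : `|eta| <= 1.
  by rewrite normrM normfV (gtr0_norm t3) ler_pdivrMr// mul1r ltW.
pose F z := g (t - tau ^+ 6) (x - tau ^+ 3 * z).
have cF : continuous F by exact: continuous_smooth_arg.
have E1 : smooth j g tau t (x + h) = \int[mu]_z (skernel j tau (z + eta) * F z).
  rewrite /smooth (@Rintegral_shift _ _ eta).
    apply: eq_Rintegral => z _; congr (_ * g _ _).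
    by rewrite /eta; field; rewrite gt_eqF.
  move=> z; apply: cvgM; first exact: continuous_skernel.
  exact: continuous_smooth_arg.
have cs : continuous (fun z => skernel j tau (z + eta)).
  move=> z; apply: (@continuous_comp _ _ _ (fun z => z + eta) (skernel j tau)).
    by apply: cvgD; [exact: cvg_id|exact: cvg_cst].
  exact: continuous_skernel.
have i1 : mu.-integrable [set: RR] (EFin \o (fun z => skernel j tau (z + eta) * F z)).
  apply: (@integrable_dominated _ _ _ (fun z => (B * (C' * 3)) * (oneDsqr z)^-1)) => //.
  - apply: continuous_measurable_fun => z; apply: cvgM; [exact: cs|exact: cF].
  - exact: (integrableZl measurableT (B * (C' * 3)) iw).
  - move=> z _; rewrite normrM mulrC -mulrA ler_pM//; first exact: hB.
    rewrite (le_trans (hC' _ _))// -mulrA ler_wpM2l// oneDsqrV_shift//.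
    by rewrite addrAC subrr add0r.
have i2 : mu.-integrable [set: RR] (EFin \o (fun z => skernel j tau z * F z)).
  exact: smooth_integrable.
have i3 : mu.-integrable [set: RR] (EFin \o (fun z => eta * (skernel j.+1 tau z * F z))).
  exact: (integrableZl measurableT eta (smooth_integrable j.+1 tau t x bg)).
have E : tau ^+ 3 * smooth j g tau t (x + h) - tau ^+ 3 * smooth j g tau t x -
    h * smooth j.+1 g tau t x =
    tau ^+ 3 * \int[mu]_z (skernel j tau (z + eta) * F z - skernel j tau z * F z -
      eta * (skernel j.+1 tau z * F z)).
  rewrite RintegralB//; last exact: (integrableB measurableT i1 i2).
  rewrite RintegralB// RintegralZl//; last exact: smooth_integrable.
  rewrite -E1 -/(smooth j g tau t x) -/(smooth j.+1 g tau t x).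
  rewrite !mulrBr; congr (_ - _); rewrite mulrA; congr (_ * _).
  by rewrite /eta; field; rewrite gt_eqF.
rewrite E normrM (gtr0_norm t3).
have hI : `|\int[mu]_z (skernel j tau (z + eta) * F z - skernel j tau z * F z -
      eta * (skernel j.+1 tau z * F z))| <= C * B * eta ^+ 2 * Iw.
  rewrite -RintegralZl//; apply: normr_Rintegral_dominated => //.
  - apply: continuous_measurable_fun => z.
    apply: cvgB; last (apply: cvgM; first exact: cvg_cst); last first.
      by apply: cvgM; [exact: continuous_skernel|exact: cF].
    apply: cvgB; apply: cvgM; [exact: cs|exact: cF|exact: continuous_skernel|exact: cF].
  - exact: (integrableZl measurableT (C * B * eta ^+ 2) iw).
  - move=> z _.
    rewrite (_ : skernel j tau (z + eta) * F z - skernel j tau z * F z -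
      eta * (skernel j.+1 tau z * F z) = (skernel j tau (z + eta) - skernel j tau z -
      eta * skernel j.+1 tau z) * F z); last by ring.
    rewrite normrM (_ : C * B * eta ^+ 2 * _ = (C * (oneDsqr z)^-1 * eta ^+ 2) * B); last by ring.
    by rewrite ler_pM// ?hC// hB.
rewrite (le_trans (ler_wpM2l (ltW t3) hI))//.
rewrite (_ : tau ^+ 3 * (C * B * eta ^+ 2 * Iw) = (C * B * Iw) * (h ^+ 2 / tau ^+ 3)); last first.
  by rewrite /eta; field; rewrite gt_eqF.
rewrite -(real_normK (num_real h)) expr2.
rewrite (_ : C * B * Iw * (`|h| * `|h| / tau ^+ 3) = C * B * Iw * `|h| / tau ^+ 3 * `|h|);
  last by ring.
rewrite ler_wpM2r// ler_pdivrMr//.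
rewrite (@le_trans _ _ (Q * `|h|))//; first by rewrite ler_wpM2r// lerDl.
by rewrite -ler_pdivlMl// mulrC ltW.
Qed.

(** Here the derivative falls on [phi], so no power of [tau] is lost and [tau = 0] is included. It
    serves the datum, [is_derive_smooth] the source term. *)
Lemma is_derive_smooth_cst j phi dphi tau t x :
  (forall x, is_derive x (1 : R) phi (dphi x)) ->
  BUC2 (fun=> phi) -> BUC2 (fun=> dphi) ->
  is_derive x (1 : R) (fun x => smooth j (fun=> phi) tau t x)
    (smooth j (fun=> dphi) tau t x).
Proof.
move=> dp bp bdp; have [K K0 hK] := @skernel_bound R j.
apply: is_derive_le => e e0.
have K10 : 0 < K + 1 by rewrite ltr_wpDl.
have [_ /(_ (e / (K + 1)) (divr_gt0 e0 K10))[d d0 hd]] := bdp.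
exists d => // h hh.
pose P z := phi (x + h - tau ^+ 3 * z) - phi (x - tau ^+ 3 * z) - h * dphi (x - tau ^+ 3 * z).
have i1 := smooth_integrable j tau t (x + h) bp.
have i2 := smooth_integrable j tau t x bp.
have i3 := smooth_integrable j tau t x bdp.
have i4 := integrableZl measurableT h i3.
have -> : smooth j (fun=> phi) tau t (x + h) - smooth j (fun=> phi) tau t x -
    h * smooth j (fun=> dphi) tau t x = \int[mu]_z (skernel j tau z * P z).
  rewrite /smooth -RintegralZl// -RintegralB// -RintegralB//;
    last exact: (integrableB measurableT i1 i2).
  by apply: eq_Rintegral => z _; rewrite /P !mulrBr (mulrCA h).
have hP z : `|P z| <= e / (K + 1) * `|h|.
  rewrite /P (_ : x + h - _ = x - tau ^+ 3 * z + h); last by ring.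
  apply: (Taylor1_bound dp) => s hs.
  by apply: (hd 0 0); rewrite ?subrr ?normr0// (le_lt_trans hs).
apply: (le_trans (hK _ _ _ _ hP)).
  move=> z; apply: cvgB.
    apply: cvgB; first exact: (@continuous_smooth_arg _ _ tau t (x + h) bp z).
    exact: (@continuous_smooth_arg _ _ tau t x bp z).
  apply: cvgM; first exact: cvg_cst.
  exact: (@continuous_smooth_arg _ _ tau t x bdp z).
rewrite mulrA ler_wpM2r// mulrCA ler_piMr// ?ltW// ltr_pdivrMr// mul1r.
by rewrite ltrDl.
Qed.

End smooth_derivative.

(** * The Duhamel term *)

Section Duhamel.
Context {R : realType}.
Local Notation mu := (@lebesgue_measure R).
Local Notation RR := (measurableTypeR R).
Implicit Types (phi : R -> R) (g : R -> R -> R).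

Lemma integrable_itv_continuous (f : R -> R) (i : interval R) (r s : R) :
  [set` i] `<=` `[r, s] -> continuous f -> mu.-integrable [set` i] (EFin \o f).
Proof.
move=> ir cf; apply: (@integrableS _ _ _ mu `[r, s]) => //.
apply: continuous_compact_integrable; first exact: segment_compact.
exact: continuous_subspaceT.
Qed.

(** The flag [b] for the left end serves both [[0, r]] and the difference []r', r]] of two such
    intervals. *)
Lemma normr_Rintegral_itv_le (f : R -> R) (b : bool) (r s D : R) : r <= s ->
  continuous f -> (forall x, r <= x <= s -> `|f x| <= D) ->
  `|\int[mu]_(x in [set` Interval (BSide b r) (BRight s)]) f x| <= (s - r) * D.
Proof.
move=> rs cf hD.
have sub : [set` Interval (BSide b r) (BRight s)] `<=` `[r, s].
  by move=> x /=; rewrite !in_itv/=; case: b => //= /andP[/ltW -> ->].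
have -> : (s - r) * D = \int[mu]_(x in [set` Interval (BSide b r) (BRight s)]) D.
  rewrite Rintegral_cst; last exact: measurable_itv.
  rewrite /= lebesgue_measure_itv/= lte_fin.
  case: ltP => [_|sr]; first by rewrite /= mulrC.
  by rewrite (_ : s = r) ?subrr ?mul0r ?mulr0//; apply/eqP; rewrite eq_le rs sr.
apply: normr_Rintegral_dominated.
- exact: measurable_itv.
- by apply: measurable_funTS; exact: continuous_measurable_fun.
- by apply: (integrable_itv_continuous sub) => x; exact: cvg_cst.
- by move=> x /sub; rewrite /= in_itv/=; exact: hD.
Qed.

(** With [r = root6 t], the pair [j = 0, n = 5] is the integral of [E(t - s) g(s)] under
    [s = t - tau^6], and [j = 1, n = 2] is its [x]-derivative, since [tau^5 * tau^-3 = tau^2].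
    Keeping [r] apart from [t] lets the two variations be estimated separately. *)
Definition duhamel (j n : nat) g (r t x : R) : R :=
  \int[mu]_(tau in `[0, r]) (6 * tau ^+ n * smooth j g tau t x).

Lemma continuous_duhamel_arg j n g t x : BUC2 g ->
  continuous (fun tau : R => 6 * tau ^+ n * smooth j g tau t x).
Proof.
move=> bg tau; apply: cvgM; last exact: continuous_smooth.
by apply: cvgM; [exact: cvg_cst|exact: exprn_continuous].
Qed.

Lemma duhamel_integrable j n g r t x : BUC2 g ->
  mu.-integrable `[0, r] (EFin \o (fun tau => 6 * tau ^+ n * smooth j g tau t x)).
Proof.
move=> bg; apply: (@integrable_itv_continuous _ _ 0 r) => //.
exact: (@continuous_duhamel_arg j n g t x bg).
Qed.

Lemma duhamel_bound j n : exists2 K : R, 0 <= K & forall g (r t x B : R), BUC2 g ->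
  0 <= r <= 1 -> (forall s y, `|g s y| <= B) -> `|duhamel j n g r t x| <= r * (K * B).
Proof.
have [K K0 hK] := @smooth_bound R j; exists (6 * K); first by rewrite mulr_ge0.
move=> g r t x B bg /andP[r0 r1] hB.
have := @normr_Rintegral_itv_le _ true 0 r (6 * K * B) r0 (@continuous_duhamel_arg j n g t x bg).
rewrite subr0; apply => tau /andP[tau0 taur].
rewrite normrM -mulrA ler_pM//; last by apply: hK => // y; exact: hB.
rewrite normrM normr_nat ler_piMr// normrX ger0_norm// exprn_ile1//.
exact: le_trans r1.
Qed.

Lemma duhamel_r j n : exists2 K : R, 0 <= K & forall g (r r' t x B : R), BUC2 g ->
  0 <= r <= 1 -> 0 <= r' <= 1 -> (forall s y, `|g s y| <= B) ->
  `|duhamel j n g r t x - duhamel j n g r' t x| <= `|r - r'| * (K * B).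
Proof.
have [K K0 hK] := @smooth_bound R j; exists (6 * K); first by rewrite mulr_ge0.
move=> g r r' t x B bg hr hr' hB.
wlog rr : r r' hr hr' / r' <= r.
  move=> H; case: (leP r' r) => [|/ltW] h; first exact: H.
  by rewrite distrC [X in X * _]distrC; exact: H.
have /andP[r0 r1] := hr; have /andP[r0' r1'] := hr'.
rewrite /duhamel Rintegral_itvB//; last exact: (@duhamel_integrable j n g r t x bg).
rewrite [X in X * _]ger0_norm ?subr_ge0//.
apply: (@normr_Rintegral_itv_le _ false) => //.
  exact: continuous_duhamel_arg.
move=> tau /andP[tau0 taur].
have {}tau0 : 0 <= tau by rewrite (le_trans r0').
rewrite normrM -mulrA ler_pM//; last by apply: hK => // y; exact: hB.
rewrite normrM normr_nat ler_piMr// normrX ger0_norm// exprn_ile1//.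
exact: le_trans r1.
Qed.

Lemma duhamelB j n g g' r t t' x x' : BUC2 g -> BUC2 g' ->
  duhamel j n g r t x - duhamel j n g' r t' x' =
  \int[mu]_(tau in `[0, r]) (6 * tau ^+ n *
    (smooth j g tau t x - smooth j g' tau t' x')).
Proof.
move=> bg bg'; rewrite /duhamel -RintegralB//; [|exact: duhamel_integrable..].
by apply: eq_Rintegral => tau _; rewrite mulrBr.
Qed.

Let continuous_argB j n g g' t t' x x' : BUC2 g -> BUC2 g' ->
  continuous (fun tau : R => 6 * tau ^+ n * (smooth j g tau t x - smooth j g' tau t' x')).
Proof.
move=> bg bg' tau; apply: cvgM.
  by apply: cvgM; [exact: cvg_cst|exact: exprn_continuous].
by apply: cvgB; exact: continuous_smooth.
Qed.

Lemma duhamel_ucont j n g : BUC2 g -> forall e : R, 0 < e ->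
  exists2 d : R, 0 < d & forall r r' t t' x x' : R, 0 <= r <= 1 -> 0 <= r' <= 1 ->
    `|r - r'| < d -> `|t - t'| < d -> `|x - x'| < d ->
    `|duhamel j n g r t x - duhamel j n g r' t' x'| <= e.
Proof.
move=> bg e e0; have [[B hB] ug] := bg.
have B0 : 0 <= B by rewrite (le_trans _ (hB 0 0)).
have [K K0 hK] := duhamel_r j n.
have [K' K'0 hK'] := @smooth_diff R j.
have e1 : 0 < e / 2 / (6 * K' + 1) by rewrite !divr_gt0// ltr_wpDl// mulr_ge0.
have [d1 d10 hd1] := ug _ e1.
have KB0 : 0 < K * B + 1 by rewrite ltr_wpDl// mulr_ge0.
have d0 : 0 < Num.min d1 (e / 2 / (K * B + 1)).
  by rewrite lt_min d10 !divr_gt0.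
exists (Num.min d1 (e / 2 / (K * B + 1))) => // r r' t t' x x' hr hr'.
rewrite !lt_min => /andP[_ h1] /andP[h2 _] /andP[h3 _].
rewrite (_ : _ - _ = (duhamel j n g r t x - duhamel j n g r' t x) +
  (duhamel j n g r' t x - duhamel j n g r' t' x')); last by rewrite addrA subrK.
rewrite [leRHS](splitr e) (le_trans (ler_normD _ _))// lerD//.
  apply: (le_trans (hK _ _ _ _ _ _ bg hr hr' hB)).
  rewrite (@le_trans _ _ (`|r - r'| * (K * B + 1)))//.
    by rewrite ler_wpM2l// lerDl.
  by rewrite -ler_pdivlMr// ltW.
rewrite duhamelB//; have /andP[r0 r1] := hr'.
have cA := @continuous_argB j n g g t t' x x' bg bg.
have := @normr_Rintegral_itv_le _ true 0 r' (6 * (K' * (e / 2 / (6 * K' + 1)))) r0 cA.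
rewrite subr0 => h; apply: (le_trans (h _)) => [tau /andP[tau0 taur]|].
  rewrite normrM ler_pM//.
    rewrite normrM normr_nat ler_piMr// normrX ger0_norm// exprn_ile1//.
    exact: le_trans r1.
  apply: hK' => // z; apply: hd1.
    by rewrite opprB addrA addrNK.
  by rewrite opprB addrA addrNK.
rewrite (@le_trans _ _ (6 * (K' * (e / 2 / (6 * K' + 1)))))//.
  by rewrite ler_piMl//; do 2 apply: mulr_ge0 => //; exact: ltW.
rewrite mulrA mulrCA ler_piMr// ?divr_ge0// ?ltW// ltr_pdivrMr.
  by rewrite mul1r ltrDl.
by rewrite ltr_wpDl// mulr_ge0.
Qed.

(** With [w = m * tau ^+ 2] this is [w <= 1 + w ^+ 3 <= exp (w ^+ 3)], which is why the rate is the
    cube of [m]. *)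
Lemma sqr_expR_le (m tau : R) : 0 < m ->
  tau ^+ 2 * expR (- (m ^+ 3 * tau ^+ 6)) <= m^-1.
Proof.
move=> m0; rewrite expRN ler_pdivrMr ?expR_gt0// ler_pdivlMl//.
apply: (le_trans _ (expR_ge1Dx _)).
pose w := m * tau ^+ 2.
have -> : m ^+ 3 * tau ^+ 6 = w ^+ 3 by rewrite /w exprMn -exprM.
rewrite -/w; have w0 : 0 <= w by rewrite mulr_ge0 ?sqr_ge0// ltW.
have [w1|w1] := leP w 1.
  by rewrite (le_trans w1)// lerDl exprn_ge0.
rewrite (le_trans (_ : w <= w ^+ 3)) ?lerDr//.
by rewrite exprS ler_peMr// exprn_ege1// ltW.
Qed.

(* The weight [expR (m ^+ 3 * s)] turns the [tau ^+ 2] of the substituted kernel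
   into a small constant [m^-1], on any time interval. *)
Lemma duhamel_contraction j n : (2 <= n)%N ->
  exists2 K : R, 0 <= K & forall g g' (r t x D m : R), BUC2 g -> BUC2 g' -> 0 < m ->
    0 <= D -> 0 <= r <= 1 -> r ^+ 6 <= t ->
    (forall s y, 0 <= s <= t -> `|g s y - g' s y| <= D * expR (m ^+ 3 * s)) ->
    `|duhamel j n g r t x - duhamel j n g' r t x| <= K / m * (D * expR (m ^+ 3 * t)).
Proof.
move=> n2; have [K K0 hK] := @smooth_diff R j; exists (6 * K); first by rewrite mulr_ge0.
move=> g g' r t x D m bg bg' m0 D0 /andP[r0 r1] rt H.
rewrite duhamelB//.
set C := 6 * K / m * _.
have C0 : 0 <= C by rewrite !mulr_ge0// ?expR_ge0// invr_ge0 ltW.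
have cA := @continuous_argB j n g g' t t x x bg bg'.
have := @normr_Rintegral_itv_le _ true 0 r C r0 cA.
rewrite subr0 => h; apply: (le_trans (h _)) => [tau /andP[tau0 taur]|]; last first.
  by rewrite ler_piMl.
have tau1 : tau <= 1 by exact: le_trans r1.
have t6 : tau ^+ 6 <= t by rewrite (le_trans _ rt)// lerXn2r.
have hs : 0 <= t - tau ^+ 6 <= t by rewrite subr_ge0 t6/= gerBl exprn_ge0.
rewrite normrM.
have := hK g g' tau t t x x _ bg bg' (fun z => H _ _ hs) => hh.
rewrite (le_trans (ler_wpM2l _ hh))//.
rewrite normrM normr_nat normrX ger0_norm//.
rewrite mulrBr expRD.
(* As [tau <= 1], the exponents 5 and 2 both reduce to the worst case 2. *)
have htn : tau ^+ n <= tau ^+ 2 by apply: ler_wiXn2l.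
rewrite (@le_trans _ _ (6 * tau ^+ 2 *
  (K * (D * (expR (m ^+ 3 * t) * expR (- (m ^+ 3 * tau ^+ 6)))))))//.
  by rewrite ler_wpM2r ?ler_wpM2l// !mulr_ge0 ?expR_ge0.
rewrite (_ : 6 * tau ^+ 2 * _ = (6 * K * (D * expR (m ^+ 3 * t))) *
  (tau ^+ 2 * expR (- (m ^+ 3 * tau ^+ 6)))); last by ring.
rewrite /C [leRHS]mulrAC ler_wpM2l ?sqr_expR_le// !mulr_ge0 ?expR_ge0//.
Qed.

(** Written as [6 * tau ^+ 2 * (tau ^+ 3 * smooth 0 g tau t x)], the integrand has derivative
    [6 * tau ^+ 2 * smooth 1 g tau t x]. Uniform continuity of [smooth 1] up to [tau = 0] makes the
    difference quotients converge uniformly in [tau]. *)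
Lemma is_derive_duhamel g r t x : BUC2 g -> 0 <= r <= 1 ->
  is_derive x (1 : R) (fun x => duhamel 0 5 g r t x) (duhamel 1 2 g r t x).
Proof.
move=> bg /andP[r0 r1]; apply: is_derive_le => e e0.
have e60 : 0 < e / 6 by rewrite divr_gt0.
have [d d0 hd] := smooth_ucont 1 bg ler01 e60.
exists d => // h hh.
pose f tau := 6 * tau ^+ 5 * (smooth 0 g tau t (x + h) - smooth 0 g tau t x) -
  h * (6 * tau ^+ 2 * smooth 1 g tau t x).
have cf : continuous f.
  move=> tau; apply: cvgB; first exact: continuous_argB.
  by apply: cvgM; [exact: cvg_cst|exact: continuous_duhamel_arg].
have -> : duhamel 0 5 g r t (x + h) - duhamel 0 5 g r t x - h * duhamel 1 2 g r t x =
    \int[mu]_(tau in `[0, r]) f tau.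
  rewrite duhamelB// /duhamel -RintegralZl//; last exact: duhamel_integrable.
  rewrite -RintegralB//.
  - by apply: (@integrable_itv_continuous _ _ 0 r) => //; exact: continuous_argB.
  - by apply: (integrableZl _ h (@duhamel_integrable 1 2 g r t x bg)); exact: measurable_itv.
have := @normr_Rintegral_itv_le f true 0 r (e * `|h|) r0 cf.
rewrite subr0 => H; apply: (le_trans (H _)) => [tau /andP[tau0 taur]|]; last first.
  by rewrite ler_piMl// mulr_ge0// ltW.
have tau1 : tau <= 1 by exact: le_trans r1.
rewrite /f (_ : _ - _ = 6 * tau ^+ 2 * (tau ^+ 3 * smooth 0 g tau t (x + h) -
   tau ^+ 3 * smooth 0 g tau t x - h * smooth 1 g tau t x)); last first.
  by move: (smooth _ _ _ _ _) (smooth _ _ _ _ _) (smooth _ _ _ _ _) => p q s; ring.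
(* [is_derive_smooth] requires [tau > 0]; at [tau = 0] the factor [tau ^+ 2] kills the integrand. *)
move: tau0; rewrite le_eqVlt => /predU1P[<-|tau0].
  by rewrite expr0n/= mulr0 mul0r normr0 mulr_ge0// ltW.
have T := @Taylor1_bound _ _ _ x h (e / 6) (fun x => is_derive_smooth 0 t x bg tau0).
rewrite normrM normrM normr_nat normrX gtr0_norm//.
rewrite (@le_trans _ _ (6 * tau ^+ 2 * (e / 6 * `|h|)))//.
  apply: ler_wpM2l; first by rewrite mulr_ge0// sqr_ge0.
  apply: T => s hs; apply: hd; rewrite ?subrr ?normr0// ?(gtr0_norm tau0)//.
  exact: le_lt_trans hs hh.
rewrite (_ : 6 * tau ^+ 2 * _ = tau ^+ 2 * (e * `|h|)); last by field.
rewrite ler_piMl// ?mulr_ge0 ?(ltW e0)// exprn_ile1// ltW//.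
Qed.

End Duhamel.

(** * Weighted contractions *)

Section fixed_point.
Context {R : realType}.

Lemma half_powers_small (C e : R) : 0 < e -> exists n : nat, C / 2 ^+ n < e.
Proof.
move=> e0; exists (Num.truncn (C / e)).+1.
rewrite ltr_pdivrMr ?exprn_gt0// mulrC -ltr_pdivrMr//.
rewrite (lt_trans (truncnS_gt _))// -natrX ltr_nat ltn_expl//.
Qed.

Lemma half_powers_le0 (C x : R) : (forall n : nat, x <= C / 2 ^+ n) -> x <= 0.
Proof.
move=> h; rewrite leNgt; apply/negP => x0.
by have [n] := half_powers_small C x0; rewrite ltNge h.
Qed.

(** With [w n] the sum of the remaining increment bounds, [u - w] increases and [u + w] decreases,
    so the supremum of [u - w] lies in every interval [[u n - w n, u n + w n]]: the limit comes with
    its rate. *)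
Lemma geometric_cvg (u : nat -> R) (C : R) :
  (forall n, `|u n.+1 - u n| <= C / 2 ^+ n) ->
  exists l, forall n, `|u n - l| <= 2 * C / 2 ^+ n.
Proof.
move=> hu; have C0 : 0 <= C.
  by have := hu 0%N; rewrite expr0 divr1; exact: le_trans.
pose w n : R := 2 * C / 2 ^+ n.
have wS n : w n - w n.+1 = C / 2 ^+ n.
  by rewrite /w exprS; field; rewrite expf_neq0.
have w0 n : 0 <= w n by rewrite divr_ge0 ?mulr_ge0// exprn_ge0.
have inc n k : u n - w n <= u (n + k)%N - w (n + k)%N.
  elim: k => [|k IH]; first by rewrite addn0.
  rewrite (le_trans IH)// addnS.
  have := hu (n + k)%N; have := wS (n + k)%N; rewrite ler_norml => h1 /andP[h2 h3]; lra.
have dec n k : u (n + k)%N + w (n + k)%N <= u n + w n.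
  elim: k => [|k IH]; first by rewrite addn0.
  rewrite (le_trans _ IH)// addnS.
  have := hu (n + k)%N; have := wS (n + k)%N; rewrite ler_norml => h1 /andP[h2 h3]; lra.
have ab k n : u k - w k <= u n + w n.
  have [kn|/ltnW nk] := leqP k n.
    rewrite -(subnKC kn); apply: (le_trans (inc k (n - k)%N)).
    by rewrite lerD2l (le_trans _ (w0 _))// oppr_le0.
  rewrite -(subnKC nk); apply: (le_trans _ (dec n (k - n)%N)).
  by rewrite lerD2l (le_trans _ (w0 _))// oppr_le0.
pose A := [set u n - w n | n in [set: nat]].
have supA : has_sup A.
  split; first by exists (u 0%N - w 0%N); exists 0%N.
  by exists (u 0%N + w 0%N) => _ [n _ <-].
exists (sup A) => n; rewrite ler_distl; apply/andP; split.
  rewrite lerBlDr; apply: ge_sup; first by case: supA.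
  by move=> _ [k _ <-].
by rewrite -lerBlDr; apply: ub_le_sup; [case: supA|exists n].
Qed.

(** Picard iteration from 0. [G g] sees [t] only through [clamp t], so estimates on [[0, T]] hold
    for all real times, and uniform convergence passes [BUC2] and the bound [B] to the limit. *)
Lemma fixed_point_exists (G : (R -> R -> R) -> R -> R -> R) (clamp : R -> R) (B T m : R) :
  0 <= B -> 0 <= T -> 0 <= m -> (forall t, 0 <= clamp t <= T) ->
  (forall t, 0 <= t <= T -> clamp t = t) ->
  (forall g t x, G g t x = G g (clamp t) x) ->
  (forall g, BUC2 g -> (forall t x, `|g t x| <= B) ->
    BUC2 (G g) /\ forall t x, `|G g t x| <= B) ->
  (forall g g' D, BUC2 g -> BUC2 g' -> (forall t x, `|g t x| <= B) ->
    (forall t x, `|g' t x| <= B) -> 0 <= D ->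
    (forall t x, 0 <= t <= T -> `|g t x - g' t x| <= D * expR (m * t)) ->
    forall t x, 0 <= t <= T -> `|G g t x - G g' t x| <= D / 2 * expR (m * t)) ->
  exists g, [/\ BUC2 g, forall t x, `|g t x| <= B & forall t x, G g t x = g t x].
Proof.
move=> B0 T0 m0 cT cid Gc GB Gd.
pose gs n := iter n G (fun _ _ => 0).
have gsP n : BUC2 (gs n) /\ forall t x, `|gs n t x| <= B.
  elim: n => [|n [h1 h2]]; last exact: GB.
  split; last by move=> t x; rewrite normr0.
  split; first by exists 0 => t x; rewrite normr0.
  by move=> e e0; exists 1 => // *; rewrite subrr normr0 ltW.
have gsc n t x : gs n t x = gs n (clamp t) x by case: n => // n; exact: Gc.
have gsd n t x : 0 <= t <= T ->
    `|gs n.+1 t x - gs n t x| <= 2 * B / 2 ^+ n * expR (m * t).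
  elim: n t x => [|n IH] t x tT.
    rewrite expr0 divr1 (@le_trans _ _ (2 * B))//.
      rewrite mulr_natl mulr2n (le_trans (ler_normB _ _))// lerD//.
        by have [_] := gsP 1%N.
      by have [_] := gsP 0%N.
    rewrite ler_peMr ?mulr_ge0//; have /andP[t0 _] := tT.
    by rewrite -[leLHS]expR0 ler_expR mulr_ge0.
  have D0 : 0 <= 2 * B / 2 ^+ n by rewrite divr_ge0 ?mulr_ge0// exprn_ge0.
  have [b1 l1] := gsP n.+1; have [b2 l2] := gsP n.
  have := Gd _ _ _ b1 b2 l1 l2 D0 IH t x tT.
  by rewrite (_ : 2 * B / 2 ^+ n / 2 = 2 * B / 2 ^+ n.+1)// exprSr invfM mulrA.
(* On [[0, T]] the weight is at most [expR (m * T)], so the convergence is also geometric in the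
   unweighted sup norm. *)
pose C := 2 * B * expR (m * T).
have C0 : 0 <= C by rewrite !mulr_ge0// expR_ge0.
have gsC n t x : `|gs n.+1 t x - gs n t x| <= C / 2 ^+ n.
  rewrite (gsc n.+1) (gsc n) (le_trans (gsd _ _ _ (cT t)))// /C mulrAC.
  rewrite ler_wpM2r ?invr_ge0 ?exprn_ge0// ler_wpM2l ?mulr_ge0// ler_expR ler_wpM2l//.
  by have /andP[] := cT t.
have /choice[g hg] : forall p : R * R, exists l, forall n, `|gs n p.1 p.2 - l| <= 2 * C / 2 ^+ n.
  by move=> p; apply: geometric_cvg => n; exact: gsC.
pose g' t x := g (t, x).
have {}hg n t x : `|gs n t x - g' t x| <= 2 * C / 2 ^+ n by exact: (hg (t, x)).
have bg : BUC2 g'.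
  split.
    exists (B + 2 * C) => t x; rewrite -(subrK (gs 0%N t x) (g' t x)) addrC.
    rewrite (le_trans (ler_normD _ _))// lerD//; first by have [_] := gsP 0%N.
    by rewrite distrC; have := hg 0%N t x; rewrite expr0 divr1.
  move=> e e0; have e3 : 0 < e / 3 by rewrite divr_gt0.
  have [n hn] := half_powers_small (2 * C) e3.
  have [[_ ugs] _] := gsP n; have [d d0 hd] := ugs _ e3.
  exists d => // t t' x x' ht hx.
  have := hd _ _ _ _ ht hx; have := hg n t x; have := hg n t' x'.
  rewrite !ler_norml => /andP[h1 h2] /andP[h3 h4] /andP[h5 h6].
  apply/andP; split; lra.
have gB t x : `|g' t x| <= B.
  rewrite -subr_le0; apply: (@half_powers_le0 (2 * C)) => n.
  rewrite lerBlDl -(subrK (gs n t x) (g' t x)) addrC.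
  rewrite (le_trans (ler_normD _ _))// lerD//; first by have [_] := gsP n.
  by rewrite distrC.
exists g'; split => // t x.
have key s : 0 <= s <= T -> G g' s x = g' s x.
  move=> sT; apply/eqP; rewrite -subr_eq0 -normr_le0.
  apply: (@half_powers_le0 (C * expR (m * s) + C)) => n.
  have [b1 l1] := gsP n.
  have D0 : 0 <= 2 * C / 2 ^+ n by rewrite divr_ge0 ?mulr_ge0// exprn_ge0.
  have H s' y : 0 <= s' <= T -> `|g' s' y - gs n s' y| <= 2 * C / 2 ^+ n * expR (m * s').
    move=> /andP[s0 _]; rewrite distrC (le_trans (hg _ _ _))// ler_peMr//.
    by rewrite -[leLHS]expR0 ler_expR mulr_ge0.
  have := Gd _ _ _ bg b1 gB l1 D0 H s x sT.
  have := hg n.+1 s x.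
  rewrite (_ : 2 * C / 2 ^+ n / 2 * expR (m * s) = C * expR (m * s) / 2 ^+ n); last first.
    by move: (expR _) => E; field; rewrite expf_neq0.
  rewrite (_ : 2 * C / 2 ^+ n.+1 = C / 2 ^+ n); last first.
    by rewrite exprS; field; rewrite expf_neq0.
  rewrite [(C * _ + C) / _]mulrDl => h1 h2.
  rewrite -(subrKA (gs n.+1 s x)) (le_trans (ler_normD _ _))// lerD//.
rewrite Gc key ?cT//.
(* The limit was chosen separately at each point; it inherits invariance under [clamp] from the
   iterates. *)
have h n : `|g' (clamp t) x - g' t x| <= 4 * C / 2 ^+ n.
  have := hg n (clamp t) x; have := hg n t x; rewrite -gsc => h1 h2.
  rewrite -(subrKA (gs n t x)) (le_trans (ler_normD _ _))//.
  rewrite (_ : 4 * C / 2 ^+ n = 2 * C / 2 ^+ n + 2 * C / 2 ^+ n) ?lerD//; last by ring.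
  by rewrite distrC.
by apply/eqP; rewrite -subr_eq0 -normr_le0; apply: half_powers_le0 h.
Qed.

Lemma fixed_point_unique (G : (R -> R -> R) -> R -> R -> R) (B T m : R) (g g' : R -> R -> R) :
  0 <= B -> 0 <= m ->
  (forall D : R, 0 <= D ->
    (forall t x, 0 <= t <= T -> `|g t x - g' t x| <= D * expR (m * t)) ->
    forall t x, 0 <= t <= T -> `|G g t x - G g' t x| <= D / 2 * expR (m * t)) ->
  (forall t x, `|g t x| <= B) -> (forall t x, `|g' t x| <= B) ->
  (forall t x, 0 <= t <= T -> G g t x = g t x) ->
  (forall t x, 0 <= t <= T -> G g' t x = g' t x) ->
  forall t x, 0 <= t <= T -> g t x = g' t x.
Proof.
move=> B0 m0 hG hB hB' fg fg'.
have H n t x : 0 <= t <= T -> `|g t x - g' t x| <= 2 * B / 2 ^+ n * expR (m * t).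
  elim: n t x => [|n IH] t x tT.
    rewrite expr0 divr1 (@le_trans _ _ (2 * B))//.
      by rewrite mulr_natl mulr2n (le_trans (ler_normB _ _))// lerD.
    rewrite ler_peMr ?mulr_ge0//; have /andP[t0 _] := tT.
    by rewrite -[leLHS]expR0 ler_expR mulr_ge0.
  have D0 : 0 <= 2 * B / 2 ^+ n by rewrite divr_ge0 ?mulr_ge0// exprn_ge0.
  have := hG _ D0 IH t x tT; rewrite fg// fg'//.
  by rewrite (_ : 2 * B / 2 ^+ n / 2 = 2 * B / 2 ^+ n.+1)// exprSr invfM mulrA.
move=> t x tT; apply/eqP; rewrite -subr_eq0 -normr_le0.
apply: (@half_powers_le0 (2 * B * expR (m * t))) => n.
by rewrite mulrAC; exact: H.
Qed.

End fixed_point.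

(** * Sixth roots *)

Section root6.
Context {R : realType}.

Definition root6 (t : R) : R := t `^ 6^-1.

Lemma root6_ge0 t : 0 <= root6 t. Proof. exact: powR_ge0. Qed.

Lemma root6K t : 0 <= t -> root6 t ^+ 6 = t.
Proof.
by move=> t0; rewrite /root6 -powR_mulrn ?powR_ge0// -powRrM mulVf// powRr1.
Qed.

Lemma root6X s : 0 <= s -> root6 (s ^+ 6) = s.
Proof.
by move=> s0; rewrite /root6 -powR_mulrn// -powRrM mulfV// powRr1.
Qed.

Lemma root6_le s t : 0 <= s -> s <= t -> root6 s <= root6 t.
Proof.
move=> s0 st; rewrite -(@ler_pXn2r _ 6)// ?nnegrE ?root6_ge0//.
by rewrite !root6K// (le_trans s0).
Qed.

Lemma root6_le1 t : 0 <= t <= 1 -> 0 <= root6 t <= 1.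
Proof.
move=> /andP[t0 t1]; rewrite root6_ge0/=.
by rewrite -(@root6X 1)// expr1n root6_le.
Qed.

(** The modulus [e ^+ 6] comes from superadditivity: [(p + e) ^+ 6 >= p ^+ 6 + e ^+ 6] for
    nonnegative [p] and [e]. *)
Lemma root6_ucont (e : R) : 0 < e -> exists2 d : R, 0 < d & forall s t,
  0 <= s -> 0 <= t -> `|s - t| < d -> `|root6 s - root6 t| < e.
Proof.
move=> e0; exists (e ^+ 6); first by rewrite exprn_gt0.
move=> s t s0 t0.
wlog st : s t s0 t0 / s <= t.
  move=> H h; case: (leP s t) => [|/ltW] st; first exact: H.
  by rewrite distrC; apply: H => //; rewrite distrC.
have E : s - t = root6 s ^+ 6 - root6 t ^+ 6 by rewrite !root6K.
have := root6_le s0 st; rewrite E.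
move: (root6 s) (root6 t) (root6_ge0 s) (root6_ge0 t) => p q p0 q0 pq.
rewrite distrC [X in _ -> X < _]distrC !ger0_norm ?subr_ge0//; last first.
  by rewrite lerXn2r.
rewrite !ltNge; apply: contra => qp.
rewrite lerBrDl (@le_trans _ _ ((p + e) ^+ 6))//; last first.
  by rewrite lerXn2r ?nnegrE ?addr_ge0 ?(ltW e0)// addrC -lerBrDr.
rewrite -subr_ge0 (_ : _ - _ = p * e * (6 * p ^+ 4 + 15 * p ^+ 3 * e +
   20 * p ^+ 2 * e ^+ 2 + 15 * p * e ^+ 3 + 6 * e ^+ 4)); last by ring.
have e0' := ltW e0.
by rewrite !mulr_ge0// !addr_ge0// ?mulr_ge0// ?exprn_ge0// mulr_ge0// ?exprn_ge0.
Qed.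

End root6.

(** * Mild solutions *)

Section mild.
Context {R : realType}.
Local Notation mu := (@lebesgue_measure R).
Local Notation RR := (measurableTypeR R).
Implicit Types (phi : R -> R) (g u p : R -> R -> R).

(** Composition with it extends functions of time from [[0, T]] to the line, constantly beyond the
    ends, so that [BUC2] applies. *)
Definition clamp (T t : R) : R := Num.max 0 (Num.min t T).

Lemma clamp_itv T t : 0 <= T -> 0 <= clamp T t <= T.
Proof. by move=> T0; rewrite le_max lexx/= ge_max T0 ge_min lexx orbT. Qed.

Lemma clamp_id T t : 0 <= t <= T -> clamp T t = t.
Proof. by move=> /andP[t0 tT]; rewrite /clamp min_l// max_r. Qed.

Lemma clamp_lipschitz T s t : `|clamp T s - clamp T t| <= `|s - t|.
Proof.
wlog st : s t / s <= t.
  move=> H; case: (leP s t) => [|/ltW] st; first exact: H.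
  by rewrite distrC (distrC s); exact: H.
rewrite distrC (distrC s) (ger0_norm (_ : 0 <= t - s)) ?subr_ge0// /clamp.
have [h1|h1] := leP s T; have [h2|h2] := leP t T;
  (case: (leP 0 s) => h3); (case: (leP 0 t) => h4); (try case: (leP 0 T) => h5);
  rewrite ler_norml; apply/andP; split; lra.
Qed.

Lemma BUC2_mul u p : BUC2 u -> BUC2 p -> BUC2 (fun t x => u t x * p t x).
Proof.
move=> [[A hA] uu] [[B hB] up].
have A0 : 0 <= A by rewrite (le_trans _ (hA 0 0)).
have B0 : 0 <= B by rewrite (le_trans _ (hB 0 0)).
split; first by exists (A * B) => t x; rewrite normrM ler_pM.
move=> e e0.
have e1 : 0 < e / 2 / (B + 1) by rewrite !divr_gt0// ltr_wpDl.
have e2 : 0 < e / 2 / (A + 1) by rewrite !divr_gt0// ltr_wpDl.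
have [d1 d10 h1] := uu _ e1; have [d2 d20 h2] := up _ e2.
exists (Num.min d1 d2); first by rewrite lt_min d10.
move=> t t' x x'; rewrite !lt_min => /andP[t1 t2] /andP[x1 x2].
rewrite (_ : _ - _ = (u t x - u t' x') * p t x + u t' x' * (p t x - p t' x')); last first.
  by rewrite mulrBl mulrBr addrA subrK.
rewrite [leRHS](splitr e) (le_trans (ler_normD _ _))// lerD// normrM.
  rewrite (le_trans (ler_pM _ _ (h1 _ _ _ _ t1 x1) (hB _ _)))//.
  rewrite mulrAC ler_pdivrMr ?ltr_wpDl// ler_wpM2l ?lerDl//.
  by rewrite ltW// divr_gt0.
rewrite (le_trans (ler_pM _ _ (hA _ _) (h2 _ _ _ _ t2 x2)))//.
rewrite mulrC mulrAC ler_pdivrMr ?ltr_wpDl// ler_wpM2l ?lerDl//.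
by rewrite ltW// divr_gt0.
Qed.

Lemma BUC2_scale (c : R) g : BUC2 g -> BUC2 (fun t x => c * g t x).
Proof.
apply: (@BUC2_mul (fun _ _ => c)); split; first by exists `|c|.
by move=> e e0; exists 1 => // *; rewrite subrr normr0 ltW.
Qed.

Lemma BUC2_continuous1 g t : BUC2 g -> continuous (g t).
Proof.
move=> bg; apply: (@BUC2_continuous _ g (fun=> t) id bg).
  by move=> z; exact: cvg_cst.
by move=> z; exact: cvg_id.
Qed.

(** [mild 0 5 phi g] is [E(t) phi] minus the Duhamel integral of [g]; [mild 1 2] taken at the
    derivative of [phi] is its [x]-derivative. *)
Definition mild (j n : nat) phi g (t x : R) : R :=
  smooth 0 (fun=> phi) (root6 t) t x - duhamel j n g (root6 t) t x.

Lemma mild_bound j n : exists2 K : R, 0 <= K & forall phi g t x m B,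
  BUC2 (fun=> phi) -> BUC2 g -> (forall y, `|phi y| <= m) ->
  (forall s y, `|g s y| <= B) -> 0 <= t <= 1 ->
  `|mild j n phi g t x| <= K * m + root6 t * (K * B).
Proof.
have [K K0 hK] := @smooth_bound R 0; have [K' K0' hK'] := @duhamel_bound R j n.
exists (K + K'); first by rewrite addr_ge0.
move=> phi g t x m B bp bg hm hB t01.
have m0 : 0 <= m by rewrite (le_trans _ (hm 0)).
have B0 : 0 <= B by rewrite (le_trans _ (hB 0 0)).
rewrite (le_trans (ler_normB _ _))// lerD//.
  by rewrite (le_trans (hK _ _ _ _ _ bp (fun y => hm y)))// ler_wpM2r// lerDl.
rewrite (le_trans (hK' _ _ _ _ _ bg (root6_le1 t01) hB))//.
by rewrite ler_wpM2l ?root6_ge0// ler_wpM2r// lerDr.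
Qed.

Lemma mild_BUC2 j n phi g T : 0 <= T <= 1 -> BUC2 (fun=> phi) -> BUC2 g ->
  BUC2 (fun t x => mild j n phi g (clamp T t) x).
Proof.
move=> /andP[T0 T1] bp bg.
have [[m hm] _] := bp; have [[B hB] _] := bg.
have c01 t : 0 <= clamp T t <= 1.
  by have /andP[-> h] := clamp_itv t T0; exact: le_trans T1.
split.
  have [K K0 hK] := mild_bound j n.
  have B0 : 0 <= B by rewrite (le_trans _ (hB 0 0)).
  exists (K * m + K * B) => t x.
  rewrite (le_trans (hK _ _ _ _ _ _ bp bg (hm 0) hB (c01 t)))// lerD2l ler_piMl ?mulr_ge0//.
  by have /andP[] := root6_le1 (c01 t).
move=> e e0; have e20 : 0 < e / 2 by rewrite divr_gt0.
have [d1 d10 h1] := smooth_ucont 0 bp ler01 e20.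
have [d2 d20 h2] := duhamel_ucont j n bg e20.
pose d := Num.min d1 d2; have d0 : 0 < d by rewrite lt_min d10.
have [d3 d30 h3] := @root6_ucont R d d0.
exists (Num.min d3 d); first by rewrite lt_min d30.
move=> t t' x x' ht hx.
have {ht} : `|clamp T t - clamp T t'| < Num.min d3 d.
  exact: le_lt_trans (clamp_lipschitz _ _ _) ht.
rewrite lt_min => /andP[ht3].
have /andP[ct0 _] := c01 t; have /andP[ct0' _] := c01 t'.
have := h3 _ _ ct0 ct0' ht3.
move: hx; rewrite !lt_min => /and3P[_ x1 x2] /andP[r1 r2] /andP[t1 t2].
have ra s : `|root6 (clamp T s)| <= 1.
  by rewrite ger0_norm ?root6_ge0//; have /andP[] := root6_le1 (c01 s).
rewrite /mild [leRHS](splitr e).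
have := h1 _ _ _ _ _ _ (ra t) (ra t') r1 t1 x1.
have := h2 _ _ _ _ _ _ (root6_le1 (c01 t)) (root6_le1 (c01 t')) r2 t2 x2.
move: (smooth _ _ _ _ _) (smooth _ _ _ _ _) (duhamel _ _ _ _ _ _) (duhamel _ _ _ _ _ _).
move=> a b c e' H1 H2.
rewrite (_ : b - e' - (a - c) = (b - a) - (e' - c)); last by ring.
by rewrite (le_trans (ler_normB _ _))// lerD.
Qed.

Lemma mild_contraction j n : (2 <= n)%N ->
  exists2 K : R, 0 <= K & forall phi g g' t x D m, BUC2 g -> BUC2 g' -> 0 < m ->
    0 <= D -> 0 <= t <= 1 ->
    (forall s y, 0 <= s <= t -> `|g s y - g' s y| <= D * expR (m ^+ 3 * s)) ->
    `|mild j n phi g t x - mild j n phi g' t x| <= K / m * (D * expR (m ^+ 3 * t)).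
Proof.
move=> n2; have [K K0 hK] := @duhamel_contraction R j n n2; exists K => //.
move=> phi g g' t x D m bg bg' m0 D0 t01 H; rewrite /mild.
have /andP[t0 _] := t01.
have := hK g' g (root6 t) t x D m bg' bg m0 D0 (root6_le1 t01).
rewrite root6K// lexx => /(_ isT) h.
rewrite (_ : _ - _ - _ = duhamel j n g' (root6 t) t x - duhamel j n g (root6 t) t x); last first.
  by move: (smooth _ _ _ _ _) (duhamel _ _ _ _ _ _) (duhamel _ _ _ _ _ _) => a b c; ring.
by apply: h => s y hs; rewrite distrC; exact: H.
Qed.

Lemma is_derive_mild phi dphi g t x :
  (forall x, is_derive x (1 : R) phi (dphi x)) ->
  BUC2 (fun=> phi) -> BUC2 (fun=> dphi) -> BUC2 g -> 0 <= t <= 1 ->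
  is_derive x (1 : R) (mild 0 5 phi g t) (mild 1 2 dphi g t x).
Proof.
move=> dp bp bdp bg t01.
have h1 := is_derive_smooth_cst 0 (root6 t) t x dp bp bdp.
have h2 := is_derive_duhamel t x bg (root6_le1 t01).
exact: (is_deriveB h1 h2).
Qed.

Definition product_map phi dphi (T : R) g (t x : R) : R :=
  mild 0 5 phi g (clamp T t) x * mild 1 2 dphi g (clamp T t) x.

(** A single [K] serves all data, so [T] can be chosen from the norm alone. The rate [l] is allowed
    to depend on [m], [B] and [T], so the contraction holds for every radius [B] and every
    [T <= 1]. *)
Lemma product_map_contraction : exists2 K : R, 0 <= K & forall phi dphi m B T,
  BUC2 (fun=> phi) -> BUC2 (fun=> dphi) ->
  (forall y, `|phi y| <= m) -> (forall y, `|dphi y| <= m) -> 0 <= T <= 1 -> 0 <= B ->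
  (forall g t x, BUC2 g -> (forall s y, `|g s y| <= B) -> 0 <= t <= T ->
     `|mild 0 5 phi g t x| <= K * m + root6 T * (K * B) /\
     `|mild 1 2 dphi g t x| <= K * m + root6 T * (K * B)) /\
  exists2 l : R, 0 <= l & forall g g' D, BUC2 g -> BUC2 g' ->
    (forall t x, `|g t x| <= B) -> (forall t x, `|g' t x| <= B) -> 0 <= D ->
    (forall t x, 0 <= t <= T -> `|g t x - g' t x| <= D * expR (l * t)) ->
    forall t x, 0 <= t <= T ->
      `|product_map phi dphi T g t x - product_map phi dphi T g' t x| <=
      D / 2 * expR (l * t).
Proof.
have [K1 K10 h1] := mild_bound 0 5; have [K2 K20 h2] := mild_bound 1 2.
have [//|K3 K30 h3] := @mild_contraction 0 5; have [//|K4 K40 h4] := @mild_contraction 1 2.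
pose K := K1 + K2 + (K3 + K4).
have K0 : 0 <= K by rewrite !addr_ge0.
exists K => // phi dphi m B T bp bdp hm hdm /andP[T0 T1] B0.
have m0 : 0 <= m by rewrite (le_trans _ (hm 0)).
have tT t : 0 <= t <= T -> 0 <= t <= 1 by move=> /andP[-> h]; exact: le_trans T1.
have bound g t x : BUC2 g -> (forall s y, `|g s y| <= B) -> 0 <= t <= T ->
     `|mild 0 5 phi g t x| <= K * m + root6 T * (K * B) /\
     `|mild 1 2 dphi g t x| <= K * m + root6 T * (K * B).
  move=> bg hB htT; have /andP[t0 tT'] := htT.
  have r : root6 t <= root6 T by exact: root6_le.
  have aux K' : 0 <= K' -> K' <= K -> K' * m + root6 t * (K' * B) <= K * m + root6 T * (K * B).
    move=> K'0 KK; apply: lerD; first by rewrite ler_wpM2r.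
    by apply: ler_pM => //; rewrite ?root6_ge0 ?mulr_ge0// ler_wpM2r.
  split.
    apply: (le_trans (h1 _ _ _ _ _ _ bp bg hm hB (tT _ htT))); apply: aux => //.
    by rewrite /K -addrA lerDl !addr_ge0.
  apply: (le_trans (h2 _ _ _ _ _ _ bdp bg hdm hB (tT _ htT))); apply: aux => //.
  by rewrite /K (addrC K1) -addrA lerDl !addr_ge0.
split; first exact: bound.
set M := K * m + root6 T * (K * B) in bound.
have M0 : 0 <= M by rewrite addr_ge0 ?mulr_ge0 ?root6_ge0.
(* The difference of two products splits into two terms, each at most [K / mm * M] times the
   weighted distance; this choice makes each at most a quarter. *)
pose mm := 4 * M * K + 1.
have mm0 : 0 < mm by rewrite ltr_wpDl// !mulr_ge0.
exists (mm ^+ 3); first by rewrite exprn_ge0// ltW.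
move=> g g' D bg bg' hB hB' D0 H t x htT.
rewrite /product_map clamp_id//.
have [u1 p1] := bound g t x bg hB htT; have [u2 p2] := bound g' t x bg' hB' htT.
have /andP[t0 tT'] := htT.
have H' s y : 0 <= s <= t -> `|g s y - g' s y| <= D * expR (mm ^+ 3 * s).
  by move=> /andP[s0 st]; apply: H; rewrite s0 (le_trans st).
have := h3 phi g g' t x D mm bg bg' mm0 D0 (tT _ htT) H'.
have := h4 dphi g g' t x D mm bg bg' mm0 D0 (tT _ htT) H'.
set E := D * _; have E0 : 0 <= E by rewrite mulr_ge0 ?expR_ge0.
move: u1 p1 u2 p2.
move: (mild _ _ _ _ _ _) (mild _ _ _ _ _ _) (mild _ _ _ _ _ _) (mild _ _ _ _ _ _).
move=> p' u' p u hu hp hu' hp' H4 H3.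
rewrite (_ : u * p - u' * p' = (u - u') * p + u' * (p - p')); last by ring.
rewrite (_ : D / 2 * _ = E / 2); last by rewrite /E mulrAC.
have KK : K / mm * M <= 4^-1.
  rewrite mulrAC ler_pdivrMr// /mm; lra.
have k3 : K3 / mm <= K / mm.
  by rewrite ler_pM2r ?invr_gt0// /K addrA (addrC _ K3) -!addrA lerDl !addr_ge0.
have k4 : K4 / mm <= K / mm.
  by rewrite ler_pM2r ?invr_gt0// /K addrA (addrC _ K4) -!addrA lerDl !addr_ge0.
have A1 : `|(u - u') * p| <= E / 4.
  rewrite normrM (le_trans (ler_pM _ _ H3 hp))//.
  rewrite mulrAC mulrC ler_wpM2l//.
  by rewrite (le_trans _ KK)// ler_wpM2r.
have A2 : `|u' * (p - p')| <= E / 4.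
  rewrite normrM mulrC (le_trans (ler_pM _ _ H4 hu'))//.
  rewrite mulrAC mulrC ler_wpM2l//.
  by rewrite (le_trans _ KK)// ler_wpM2r.
rewrite (le_trans (ler_normD _ _))// (le_trans (lerD A1 A2))//; lra.
Qed.

Lemma semigroupE_smooth g (tau t x : R) : BUC2 g -> 0 <= tau <= 1 ->
  semigroupE (tau ^+ 6) (g (t - tau ^+ 6)) x = smooth 0 g tau t x.
Proof.
move=> bg /andP[tau0 tau1]; have [[B hB] _] := bg.
move: tau0; rewrite le_eqVlt => /predU1P[tau0|tau0]; last first.
  rewrite /smooth (@semigroupE_skernel _ _ _ _ B) ?tau0//.
  exact: BUC2_continuous1.
(* At [tau = 0] the function no longer depends on [z], and the unit mass of the kernel returns its
   value at [(t, x)]. *)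
rewrite /smooth -tau0 /semigroupE expr0n/= ltxx subr0 expr0n/=.
under eq_Rintegral do rewrite mul0r subr0.
have i0 : mu.-integrable [set: RR] (EFin \o skernel 0 (0 : R)).
  have := @skernel_integrable R 0 0 (cst 1) 1 (fun z => @cvg_cst _ _ _ _ _).
  rewrite (_ : (fun z => skernel 0 0 z * cst 1 z) = skernel 0 0).
    by apply => z; rewrite /= normr1.
  by apply/funext => z /=; rewrite mulr1.
by rewrite RintegralZr// skernel_integral1 mul1r.
Qed.

Lemma smooth_scale j (c : R) g tau t x : BUC2 g ->
  smooth j (fun t x => c * g t x) tau t x = c * smooth j g tau t x.
Proof.
move=> bg; rewrite /smooth -RintegralZl//; last exact: smooth_integrable.
by apply: eq_Rintegral => z _; rewrite mulrCA.
Qed.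

Lemma duhamel_scale j n (c : R) g r t x : BUC2 g ->
  duhamel j n (fun t x => c * g t x) r t x = c * duhamel j n g r t x.
Proof.
move=> bg; rewrite /duhamel -RintegralZl//; last exact: duhamel_integrable.
by apply: eq_Rintegral => z _; rewrite smooth_scale// mulrCA.
Qed.

Lemma semigroupE_duhamel g (t x : R) : BUC2 g -> 0 <= t <= 1 ->
  \int[mu]_(s in `[0, t]) semigroupE (t - s) (g s) x = duhamel 0 5 g (root6 t) t x.
Proof.
move=> bg t01; have /andP[t0 t1] := t01.
(* On [[0, t]] this is the integrand; the truncation makes it continuous on the whole line, across
   [s = t] included, as the substitution asks. *)
pose H (s : R) := smooth 0 g (root6 (Num.max 0 (t - s))) t x.
have cH : continuous H.
  move=> s; apply/cvgrPdist_le => e e0.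
  have cs := @continuous_smooth R 0 g t x bg (root6 (Num.max 0 (t - s))).
  have [d d0 hd] : exists2 d : R, 0 < d & forall tau,
      `|root6 (Num.max 0 (t - s)) - tau| < d ->
      `|H s - smooth 0 g tau t x| <= e.
    have /cvgrPdist_le/(_ _ e0)/nbhs_ballP[d d0 hd] := cs.
    by exists d => // tau htau; exact: hd.
  have [d' d'0 hd'] := root6_ucont d0.
  near=> s'; apply: hd; apply: hd'; rewrite ?le_max ?lexx//.
  have : `|s - s'| < d'.
    by near: s'; apply: (@cvgr_dist_lt _ _ _ _ _ id s cvg_id).
  apply: le_lt_trans.
  rewrite (_ : s - s' = - ((t - s) - (t - s'))); last by ring.
  rewrite normrN; move: (t - s) (t - s') => p q.
  have [h1|h1] := leP 0 p; have [h2|h2] := leP 0 q; rewrite ?subrr ?normr0// ?subr0 ?sub0r.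
    rewrite ger0_norm// ger0_norm; lra.
  rewrite normrN ger0_norm// ltr0_norm; lra.
have HE (s : R) : s \in `[0, t]%classic -> semigroupE (t - s) (g s) x = H s.
  rewrite inE/= in_itv/= => /andP[s0 st].
  rewrite /H max_r ?subr_ge0//.
  have h01 : 0 <= root6 (t - s) <= 1 by apply: root6_le1; rewrite subr_ge0 st/=; lra.
  have ts : 0 <= t - s by rewrite subr_ge0.
  have := semigroupE_smooth t x bg h01; rewrite root6K//.
  by rewrite (_ : t - (t - s) = s)//; ring.
transitivity (\int[mu]_(s in `[0, t]) H s); first exact: eq_Rintegral.
pose F (tau : R) := t - tau ^+ 6.
have dF (tau : R) : is_derive tau (1 : R) F (- (6 * tau ^+ 5)).
  by rewrite /F; apply: is_derive_eq; rewrite /GRing.scale/=; ring.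
have F'E : F^`()%classic = (fun tau => - (6 * tau ^+ 5)).
  by apply/funext => tau; rewrite derive1E; have [_ ->] := dF tau.
have cF : continuous F.
  by move=> tau; apply/differentiable_continuous/derivable1_diffP; case: (dF tau).
have c5 : continuous (fun tau : R => - (6 * tau ^+ 5)).
  by move=> tau; apply: cvgN; apply: cvgM; [exact: cvg_cst|exact: exprn_continuous].
have F0 : F 0 = t by rewrite /F expr0n/= subr0.
have Fr : F (root6 t) = 0 by rewrite /F root6K// subrr.
rewrite /duhamel /Rintegral.
have := @integration_by_substitution_decreasing _ F H 0 (root6 t) (root6_ge0 t).
rewrite F0 Fr F'E => ->.
- congr fine; apply: eq_integral => tau; rewrite inE/= in_itv/= => /andP[tau0 taur].
  transitivity ((H (F tau) * - - (6 * tau ^+ 5))%:E) => //.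
  have -> : H (F tau) = smooth 0 g tau t x.
    rewrite /H (_ : t - F tau = tau ^+ 6); last by rewrite /F; ring.
    by rewrite max_r ?exprn_ge0// root6X.
  by rewrite opprK mulrC.
- move=> a b; rewrite !in_itv/= => /andP[a0 _] /andP[b0 _] ab.
  by rewrite /F ltrD2l ltrN2 ltrXn2r.
- by move=> tau _; exact: c5.
- by apply/cvg_ex; exists (- (6 * 0 ^+ 5)); apply: cvg_at_right_filter; exact: c5.
- by apply/cvg_ex; exists (- (6 * root6 t ^+ 5)); apply: cvg_at_left_filter; exact: c5.
- split.
  + by move=> tau _; case: (dF tau).
  + by apply: cvg_at_right_filter; exact: cF.
  + by apply: cvg_at_left_filter; exact: cF.
- exact: continuous_subspaceT.
Unshelve. all: end_near. Qed.

(* [g] stands for [u * u_x], half of the [x]-derivative of [u ^ 2]. *)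
Lemma mildE phi g t x : BUC2 (fun=> phi) -> BUC2 g -> 0 <= t <= 1 ->
  mild 0 5 phi g t x = semigroupE t phi x -
    2^-1 * \int[mu]_(s in `[0, t]) semigroupE (t - s) (fun y => 2 * g s y) x.
Proof.
move=> bp bg t01; have /andP[t0 t1] := t01.
rewrite (semigroupE_duhamel x (BUC2_scale 2 bg) t01) duhamel_scale// mulrA mulVf// mul1r.
rewrite /mild; congr (_ - _).
have := semigroupE_smooth t x bp (root6_le1 t01); rewrite root6K//.
Qed.

End mild.

(** * The space X and its norm *)

Section function_spaces_facts.
Context {R : realType}.
Local Notation mu := (@lebesgue_measure R).
Local Notation RR := (measurableTypeR R).
Implicit Types f : R -> R.

Lemma bounded_funP f : bounded_fun f <-> exists B, forall x, `|f x| <= B.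
Proof.
split=> [[M [Mr hM]]|[B hB]].
  by exists (M + 1) => x; apply: hM => //; rewrite ltrDl.
by exists B; split; [exact: num_real|move=> y By x _; exact: le_trans (hB x) (ltW By)].
Qed.

Lemma linfty_norm_bounded f B : (forall x, `|f x| <= B) ->
  ('N[mu]_+oo[EFin \o f] = (linfty_norm f)%:E)%E /\ 0 <= linfty_norm f <= B.
Proof.
move=> hB.
have B0 : 0 <= B by rewrite (le_trans _ (hB 0)).
have h0 : (0 <= 'N[mu]_+oo[EFin \o f])%E by exact: Lnorm_ge0.
have h1 : ('N[mu]_+oo[EFin \o f] <= B%:E)%E.
  rewrite unlock; case: ifPn => _; last by rewrite lee_fin.
  by apply/ess_supP; apply: aeW => x; rewrite /= lee_fin.
rewrite /linfty_norm; move: h0 h1; case: ('N[mu]_+oo[_])%E => [r| |]//=.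
by rewrite !lee_fin => -> ->.
Qed.

(** If [|f|] exceeded the essential supremum at [x], by continuity it would do so on a ball, which
    has positive measure. *)
Lemma linfty_norm_ge f B x : continuous f -> (forall x, `|f x| <= B) ->
  `|f x| <= linfty_norm f.
Proof.
move=> cf hB; have [E _] := linfty_norm_bounded hB.
rewrite leNgt; apply/negP => lt_x.
have muT : (0 < mu [set: RR])%E.
  apply: (@lt_le_trans _ _ (mu (ball (0 : R) 1))).
    by rewrite lebesgue_measure_ball// lte_fin pmulrn_lgt0.
  by apply: le_measure; rewrite ?inE//; exact: measurable_ball.
have ae : \forall y \ae mu, (`|(f y)%:E| <= (linfty_norm f)%:E)%E.
  have h : (ess_sup mu (abse \o (EFin \o f)) <= (linfty_norm f)%:E)%E.
    by rewrite -E unlock ifT.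
  by move/ess_supP : h.
have [N [mN N0 hN]] := ae.
have cnf : continuous (fun y => `|f y|).
  by move=> y; apply: cvg_norm; exact: cf.
have /cvgrPdist_lt/(_ _ (_ : 0 < `|f x| - linfty_norm f)) := cnf x.
rewrite subr_gt0 => /(_ lt_x)/nbhs_ballP[d /= d0 hd].
have sub : ball x d `<=` N.
  move=> y xy; apply: hN => /=; rewrite lee_fin => fy.
  have := hd y xy; rewrite ltNge => /negP; apply.
  by rewrite (le_trans _ (ler_norm _))// lerB.
have : (mu (ball x d) <= mu N)%E.
  by apply: le_measure => //; rewrite inE//; exact: measurable_ball.
rewrite N0 lebesgue_measure_ball; last exact: ltW.
by rewrite lee_fin leNgt pmulrn_lgt0// d0.
Qed.

Lemma unif_continuousP f : unif_continuous f <->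
  forall e : R, 0 < e -> exists2 d : R, 0 < d & forall x y, `|x - y| < d -> `|f x - f y| < e.
Proof.
rewrite /unif_continuous -!entourage_ballE; split.
  move=> h e e0.
  have [|d /= d0 hd] := h [set xy | ball xy.1 e xy.2]; first by exists e.
  by exists d => // x y xy; exact: (hd (x, y)).
move=> h A [e /= e0 he]; have [d d0 hd] := h e e0.
by exists d => // -[x y] /= xy; apply: he; exact: hd.
Qed.

Lemma spaceX_derive f x : spaceX f -> is_derive x (1 : R) f (derive1 f x).
Proof. by move=> [[df _ _] _]; apply: DeriveDef; rewrite // derive1E. Qed.

Lemma spaceX_norm f : spaceX f ->
  (forall x, `|f x| <= Cb1_norm f) /\ (forall x, `|derive1 f x| <= Cb1_norm f).
Proof.
move=> [[_ [cf /bounded_funP[B hB]] [cdf /bounded_funP[B' hB']]] _].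
have [_ /andP[h1 _]] := linfty_norm_bounded hB.
have [_ /andP[h2 _]] := linfty_norm_bounded hB'.
split=> x; rewrite /Cb1_norm.
  by rewrite (le_trans (linfty_norm_ge _ cf hB))// lerDl.
by rewrite (le_trans (linfty_norm_ge _ cdf hB'))// lerDr.
Qed.

Lemma spaceX_BUC2 f : spaceX f -> BUC2 (fun=> f) /\ BUC2 (fun=> derive1 f).
Proof.
move=> Xf; have [h1 h2] := spaceX_norm Xf; set m := Cb1_norm f in h1 h2.
have m0 : 0 <= m by rewrite (le_trans _ (h1 0)).
split; split; try by exists m.
  move=> e e0; exists (e / (m + 1)); first by rewrite divr_gt0// ltr_wpDl.
  move=> _ _ x y _ xy.
  have := MVT_bound (fun t => spaceX_derive t Xf) (fun t _ => h2 t) (x := y) (h := x - y).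
  rewrite (_ : y + (x - y) = x); last by ring.
  move=> /le_trans; apply.
  rewrite (@le_trans _ _ ((m + 1) * `|x - y|))//; first by rewrite ler_wpM2r// lerDl.
  by rewrite -ler_pdivlMl ?ltr_wpDl// mulrC ltW.
move=> e e0; have [_ /unif_continuousP/(_ e e0)[d d0 hd]] := Xf.
by exists d => // _ _ x y _ xy; rewrite ltW// hd.
Qed.

Lemma derive1B f (g : R -> R) : (forall x : R, derivable f x 1) ->
  (forall x : R, derivable g x 1) -> derive1 (f \- g) = derive1 f \- derive1 g.
Proof.
move=> df dg; apply/funext => x; rewrite derive1E /=.
rewrite (derive1E f) (derive1E g).
exact: deriveB.
Qed.

Lemma Cb1_normB_le f (g : R -> R) (B : R) :
  (forall x : R, derivable f x 1) -> (forall x : R, derivable g x 1) ->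
  (forall x, `|f x - g x| <= B) -> (forall x, `|derive1 f x - derive1 g x| <= B) ->
  0 <= Cb1_norm (f \- g) <= B + B.
Proof.
move=> df dg h1 h2.
have E := derive1B df dg.
have [_ /andP[a1 a2]] := @linfty_norm_bounded (f \- g) B h1.
have [_ /andP[b1 b2]] := @linfty_norm_bounded (derive1 f \- derive1 g) B h2.
by rewrite /Cb1_norm E addr_ge0// lerD.
Qed.

Lemma spaceXI f : (forall x : R, derivable f x 1) -> BUC2 (fun=> f) ->
  BUC2 (fun=> derive1 f) -> spaceX f.
Proof.
move=> df bf bdf; split; last first.
  apply/unif_continuousP => e e0; have e20 : 0 < e / 2 by rewrite divr_gt0.
  have [_ /(_ _ e20)[d d0 hd]] := bdf.
  exists d => // x y xy; rewrite (@le_lt_trans _ _ (e / 2))//.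
    by apply: (hd 0 0) => //; rewrite subrr normr0.
  by rewrite ltr_pdivrMr// ltr_pMr// ltr1n.
have [[B hB] _] := bf; have [[B' hB'] _] := bdf.
split; first exact: df.
  split; first exact: (@BUC2_continuous1 R _ 0 bf).
  by apply/bounded_funP; exists B => x; exact: (hB 0).
split; first exact: (@BUC2_continuous1 R _ 0 bdf).
by apply/bounded_funP; exists B' => x; exact: (hB' 0).
Qed.

Lemma BUC2B (u p : R -> R -> R) : BUC2 u -> BUC2 p -> BUC2 (fun t x => u t x - p t x).
Proof.
move=> [[A hA] uu] [[B hB] up]; split.
  by exists (A + B) => t x; rewrite (le_trans (ler_normB _ _))// lerD.
move=> e e0; have e20 : 0 < e / 2 by rewrite divr_gt0.
have [d1 d10 h1] := uu _ e20; have [d2 d20 h2] := up _ e20.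
exists (Num.min d1 d2); first by rewrite lt_min d10.
move=> t t' x x'; rewrite !lt_min => /andP[t1 t2] /andP[x1 x2].
rewrite (_ : _ - _ = (u t x - u t' x') - (p t x - p t' x')); last by ring.
by rewrite [leRHS](splitr e) (le_trans (ler_normB _ _))// lerD ?h1 ?h2.
Qed.

Lemma spaceXB f g : spaceX f -> spaceX g -> spaceX (f \- g).
Proof.
move=> Xf Xg; have [bf bdf] := spaceX_BUC2 Xf; have [bg bdg] := spaceX_BUC2 Xg.
have [[df _ _] _] := Xf; have [[dg _ _] _] := Xg.
apply: spaceXI.
- by move=> x; exact: derivableB.
- exact: BUC2B bf bg.
- by rewrite (derive1B df dg); exact: BUC2B bdf bdg.
Qed.

(** Heine-Cantor in time only: [x] ranges over a noncompact line, so its modulus is supplied by each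
    slice [w t] and transferred to nearby times by continuity uniform in [x]. *)
Lemma clamped_BUC2 (T : R) (w : R -> R -> R) : 0 <= T ->
  (forall t, t \in `[0, T] -> BUC2 (fun=> w t)) ->
  (forall t (e : R), t \in `[0, T] -> 0 < e -> exists2 d : R, 0 < d &
    forall s x, s \in `[0, T] -> `|s - t| < d -> `|w s x - w t x| <= e) ->
  BUC2 (fun t x => w (clamp T t) x).
Proof.
move=> T0 hw cw.
have cK : compact `[0, T]%classic by exact: segment_compact.
move/compact_near_coveringP/near_covering_withinP : cK => cK.
have ci t : clamp T t \in `[0, T] by rewrite in_itv/= clamp_itv.
split.
  (* Compactness is used in near-covering form: the filter at [+oo] carries the bound [M] here, and
     the filter [0^'+] carries the modulus [d] further down. *)
  have := @cK R (+oo%R) (fun M t => forall x, `|w t x| <= M) _ _.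
  case=> [t0 /= Kt0|M [Mr hM]]; last first.
    exists (M + 1) => t x; apply: (hM (M + 1)); first by rewrite ltrDl.
    exact: ci.
  have [[B hB] _] := hw _ Kt0; have [d d0 hd] := cw _ _ Kt0 ltr01.
  near=> t M => /= Kt x.
  have M1 : 1 + B <= M by near: M; apply: nbhs_pinfty_ge; exact: num_real.
  have t1 : `|t - t0| < d.
    rewrite distrC; near: t; exact: (@cvgr_dist_lt _ _ _ _ _ id t0 cvg_id).
  rewrite -(subrK (w t0 x) (w t x)) (le_trans (ler_normD _ _))//.
  by rewrite (le_trans (lerD (hd _ x Kt t1) (hB 0 x))).
move=> e e0.
have := @cK R (0^'+) (fun d t => forall s x y, s \in `[0, T] -> `|s - t| < d ->
  `|x - y| < d -> `|w s x - w t y| <= e) _ _.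
case=> [t0 /= Kt0|M /= M0 hM]; last first.
  exists (M / 2); first by rewrite divr_gt0.
  move=> t t' x x' ht hx.
  have M20 : 0 < M / 2 by rewrite divr_gt0.
  have MM : ball_ Num.norm 0 M (M / 2).
    by rewrite /= sub0r normrN gtr0_norm// ltr_pdivrMr// ltr_pMr// ltr1n.
  apply: (hM _ MM M20) hx; [exact: ci|exact: ci|].
  exact: le_lt_trans (clamp_lipschitz _ _ _) ht.
have e30 : 0 < e / 3 by rewrite divr_gt0.
have [_ /(_ _ e30)[d1 d10 h1]] := hw _ Kt0; have [d2 d20 h2] := cw _ _ Kt0 e30.
have d220 : 0 < d2 / 2 by rewrite divr_gt0.
near=> t d => /= Kt s x y Ks hs hx.
have dd1 : d < d1 by near: d; exact: nbhs_right_lt.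
have dd2 : d < d2 / 2 by near: d; exact: nbhs_right_lt.
have t1 : `|t - t0| < d2 / 2.
  rewrite distrC; near: t; exact: (@cvgr_dist_lt _ _ _ _ _ id t0 cvg_id).
have s1 : `|s - t0| < d2.
  rewrite -(subrKA t) (le_lt_trans (ler_normD _ _))// [ltRHS](splitr d2) ltrD//.
  exact: lt_trans hs dd2.
have t2 : `|t - t0| < d2 by rewrite (lt_trans t1)// ltr_pdivrMr// ltr_pMr// ltr1n.
have A1 := h2 s x Ks s1; have A2 := h2 t y Kt t2.
have A3 : `|w t0 x - w t0 y| <= e / 3.
  by apply: (h1 0 0); rewrite ?subrr ?normr0// (lt_trans hx).
rewrite (_ : w s x - w t y = (w s x - w t0 x) + (w t0 x - w t0 y) - (w t y - w t0 y)); last by ring.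
rewrite (_ : e = e / 3 + e / 3 + e / 3); last by field.
by rewrite (le_trans (ler_normB _ _))// lerD// (le_trans (ler_normD _ _))// lerD.
Unshelve. all: end_near. Qed.

Lemma continuous_in_X_BUC2 (T : R) (v : R -> R -> R) : 0 <= T -> continuous_in_X T v ->
  BUC2 (fun t x => v (clamp T t) x) /\ BUC2 (fun t x => derive1 (v (clamp T t)) x).
Proof.
move=> T0 [vX vc].
have cont t (e : R) : t \in `[0, T] -> 0 < e -> exists2 d : R, 0 < d &
    forall s, s \in `[0, T] -> `|s - t| < d -> Cb1_norm (v s \- v t) <= e.
  move=> tT e0; have /cvgrPdist_le/(_ _ e0) := vc t tT.
  rewrite near_withinE => /nbhs_ballP[d /= d0 hd].
  exists d => // s sT st; have := hd s; rewrite /ball/= distrC => /(_ st sT).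
  by rewrite sub0r normrN; apply: le_trans; exact: ler_norm.
split; [apply: (@clamped_BUC2 T v)|apply: (@clamped_BUC2 T (fun t => derive1 (v t)))] => //.
- by move=> t tT; have [] := spaceX_BUC2 (vX t tT).
- move=> t e tT e0; have [d d0 hd] := cont t e tT e0; exists d => // s x sT st.
  have [h _] := spaceX_norm (spaceXB (vX s sT) (vX t tT)).
  exact: le_trans (h x) (hd s sT st).
- by move=> t tT; have [] := spaceX_BUC2 (vX t tT).
- move=> t e tT e0; have [d d0 hd] := cont t e tT e0; exists d => // s x sT st.
  have [_ h] := spaceX_norm (spaceXB (vX s sT) (vX t tT)).
  have [[ds _ _] _] := vX s sT; have [[dt _ _] _] := vX t tT.
  by have := le_trans (h x) (hd s sT st); rewrite (derive1B ds dt).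
Qed.

(** A modulus in [t] uniform in [x] is continuity for the sup norm; having it for [u] and for its
    [x]-derivative gives continuity in the norm of X. *)
Lemma BUC2_continuous_in_X (T : R) (u p : R -> R -> R) :
  BUC2 u -> BUC2 p -> (forall t x, t \in `[0, T] -> is_derive x (1 : R) (u t) (p t x)) ->
  continuous_in_X T u.
Proof.
move=> bu bp du.
have d1 t : t \in `[0, T] -> derive1 (u t) = p t.
  by move=> tT; apply/funext => x; rewrite derive1E; have [_ ->] := du t x tT.
have dd t : t \in `[0, T] -> forall x : R, derivable (u t) x 1.
  by move=> tT x; have [] := du t x tT.
have slice g t : BUC2 g -> BUC2 (fun=> g t).
  move=> [[B hB] ug]; split; first by exists B => _ x; exact: hB.
  move=> e e0; have [d d0 hd] := ug e e0; exists d => // _ _ x x' _ hx.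
  by apply: hd => //; rewrite subrr normr0.
split.
  by move=> t tT; apply: spaceXI; [exact: dd|exact: slice|rewrite d1//; exact: slice].
move=> t tT; apply/cvgrPdist_le => e e0; have e20 : 0 < e / 2 by rewrite divr_gt0.
have [_ /(_ _ e20)[da da0 ha]] := bu; have [_ /(_ _ e20)[db db0 hb]] := bp.
rewrite near_withinE; near=> s => sT.
have s1 : `|s - t| < da.
  rewrite distrC; near: s; exact: (@cvgr_dist_lt _ _ _ _ _ id t cvg_id).
have s2 : `|s - t| < db.
  rewrite distrC; near: s; exact: (@cvgr_dist_lt _ _ _ _ _ id t cvg_id).
rewrite sub0r normrN.
have /andP[n1 n2] : 0 <= Cb1_norm (u s \- u t) <= e / 2 + e / 2.
  apply: Cb1_normB_le => [||x|x]; [exact: dd|exact: dd|..].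
    by apply: ha => //; rewrite subrr normr0.
  by rewrite !d1//; apply: hb => //; rewrite subrr normr0.
by rewrite ger0_norm// [leRHS](splitr e).
Unshelve. all: end_near. Qed.

End function_spaces_facts.

(** * Existence and uniqueness *)

Section main.
Context {R : realType}.
Local Notation mu := (@lebesgue_measure R).
Implicit Types (g u v : R -> R -> R).

Lemma derive1_sqr (f : R -> R) (x : R) : derivable f x 1 ->
  derive1 (fun y => f y ^+ 2) x = 2 * (f x * derive1 f x).
Proof.
move=> df; rewrite (derive1E f).
have h : is_derive x (1 : R) f ('D_1 f x) by exact: DeriveDef.
have h2 : is_derive x (1 : R) (fun y => f y ^+ 2) (2 * (f x * 'D_1 f x)).
  by apply: is_derive_eq; rewrite /GRing.scale/=; ring.
by rewrite derive1E; have [_ ->] := h2.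
Qed.

(** The contraction estimate with [D = 0]. It is what allows two sources known to agree only on
    [[0, T]] to be exchanged. *)
Lemma mild_causal phi j n g g' t (x : R) : (2 <= n)%N -> BUC2 g -> BUC2 g' -> 0 <= t <= 1 ->
  (forall s y, 0 <= s <= t -> g s y = g' s y) -> mild j n phi g t x = mild j n phi g' t x.
Proof.
move=> n2 bg bg' t01 H; have [K K0 hK] := @mild_contraction R j n n2.
have := hK phi g g' t x 0 1 bg bg' ltr01 (lexx 0) t01.
rewrite mul0r mulr0 normr_le0 subr_eq0 => h; apply/eqP/h => s y hs.
by rewrite H// subrr normr0 mul0r.
Qed.

(* A solution is determined by [g = v * v_x], which solves a fixed-point equation. *)
Lemma solution_product (T : R) (u0 : R -> R) v : 0 <= T <= 1 -> spaceX u0 ->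
  continuous_in_X T v -> integral_equation T u0 v ->
  exists g, [/\ BUC2 g,
    forall t x, 0 <= t <= T -> product_map u0 (derive1 u0) T g t x = g t x &
    forall t, 0 <= t <= T -> v t = mild 0 5 u0 g t].
Proof.
move=> /andP[T0 T1] Xu0 cv eqv.
have [bv bdv] := continuous_in_X_BUC2 T0 cv.
have [bu0 bdu0] := spaceX_BUC2 Xu0.
pose g t x := v (clamp T t) x * derive1 (v (clamp T t)) x.
have bg : BUC2 g by exact: BUC2_mul.
have [Xv _] := cv.
have vE t : 0 <= t <= T -> v t = mild 0 5 u0 g t.
  move=> tT; have /andP[t0 t1] := tT; apply/funext => x.
  have t01 : 0 <= t <= 1 by rewrite t0 (le_trans t1).
  rewrite mildE// eqv ?in_itv//; congr (_ - _ * _).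
  apply: eq_Rintegral => s; rewrite inE/= in_itv/= => /andP[s0 st].
  have sT : 0 <= s <= T by rewrite s0 (le_trans st).
  congr semigroupE; apply/funext => y.
  rewrite /g clamp_id// derive1_sqr//.
  by have [[d _ _] _] := Xv s sT.
exists g; split => // t x tT; have /andP[t0 t1] := tT.
have t01 : 0 <= t <= 1 by rewrite t0 (le_trans t1).
rewrite /product_map /g clamp_id// vE//; congr (_ * _).
rewrite derive1E.
by have [_ ->] := is_derive_mild x (fun y => spaceX_derive y Xu0) bu0 bdu0 bg t01.
Qed.

End main.

Theorem theorem3p1 (R : realType) :
  exists T : R -> R,
    forall u0 : R -> R, spaceX u0 ->
      0 < T (Cb1_norm u0) /\
      exists u : R -> R -> R,
        [/\ continuous_in_X (T (Cb1_norm u0)) u,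
            integral_equation (T (Cb1_norm u0)) u0 u &
            forall v : R -> R -> R,
              continuous_in_X (T (Cb1_norm u0)) v ->
              integral_equation (T (Cb1_norm u0)) u0 v ->
              forall t : R, t \in `[0, T (Cb1_norm u0)] -> v t = u t].
Proof.
have [K K0 hK] := @product_map_contraction R.
(* [M m] bounds [u] and [u_x], the 1 being room for the Duhamel term, and [M m ^+ 2] bounds
   [g = u u_x]. The Duhamel term is at most [root6 T * K * M m ^+ 2], which is at most 1 when
   [root6 T] is [r m]. *)
pose M m : R := K * m + 1; pose r m : R := (1 + K * M m ^+ 2)^-1.
exists (fun m => r m ^+ 6) => u0 Xu0; set m := Cb1_norm u0.
have [hu0 hdu0] := spaceX_norm Xu0; rewrite -/m in hu0 hdu0.
have m0 : 0 <= m by rewrite (le_trans _ (hu0 0)).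
have [bu0 bdu0] := spaceX_BUC2 Xu0.
have M0 : 0 <= M m by rewrite addr_ge0// mulr_ge0.
set B := M m ^+ 2; have B0 : 0 <= B by exact: sqr_ge0.
have d0 : 0 < 1 + K * B by rewrite ltr_pwDl// mulr_ge0.
have r0 : 0 < r m by rewrite invr_gt0.
have r1 : r m <= 1 by rewrite invf_le1// lerDl mulr_ge0.
set T := r m ^+ 6.
have T0 : 0 < T by rewrite exprn_gt0.
have T1 : T <= 1 by rewrite exprn_ile1// ltW.
have T01 : 0 <= T <= 1 by rewrite ltW.
have rT : root6 T = r m by rewrite root6X// ltW.
have rK : K * m + root6 T * (K * B) <= M m.
  by rewrite rT lerD2l ler_pdivrMl// mulr1 lerDr.
split => //.
have [hb [l l0 hc]] := hK u0 (derive1 u0) m B T bu0 bdu0 hu0 hdu0 T01 B0.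
have [g [bg hgB hg]] : exists g, [/\ BUC2 g, forall t x, `|g t x| <= B &
    forall t x, product_map u0 (derive1 u0) T g t x = g t x].
  have cT t := clamp_itv t (ltW T0).
  apply: (@fixed_point_exists R (product_map u0 (derive1 u0) T) (clamp T) B T l
    B0 (ltW T0) l0 cT (@clamp_id _ T) _ _ hc).
  - by move=> g t x; rewrite /product_map (clamp_id (clamp_itv _ (ltW T0))).
  - move=> g bg hgB; split; first by apply: BUC2_mul; exact: mild_BUC2.
    move=> t x; have [h1 h2] := hb g (clamp T t) x bg hgB (clamp_itv t (ltW T0)).
    rewrite normrM /B expr2; apply: ler_pM => //.
      exact: le_trans h1 rK.
    exact: le_trans h2 rK.
have cl t : t \in `[0, T] -> 0 <= t <= T by rewrite in_itv.
have t1 t : 0 <= t <= T -> 0 <= t <= 1.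
  by move=> /andP[-> h]; exact: le_trans h T1.
pose u t x := mild 0 5 u0 g (clamp T t) x.
pose p t x := mild 1 2 (derive1 u0) g (clamp T t) x.
have du t x : t \in `[0, T] -> is_derive x (1 : R) (u t) (p t x).
  move=> /cl tT; rewrite /u /p clamp_id//.
  by apply: is_derive_mild => //; [move=> y; exact: spaceX_derive|exact: t1].
have bu : BUC2 u by exact: mild_BUC2.
have bp : BUC2 p by exact: mild_BUC2.
exists u; split.
- exact: BUC2_continuous_in_X bu bp du.
- move=> t /cl tT x; rewrite /u clamp_id// mildE ?t1//; congr (_ - _ * _).
  have /andP[t0 tT'] := tT.
  apply: eq_Rintegral => s; rewrite inE/= in_itv/= => /andP[s0 st].
  have sT : s \in `[0, T] by rewrite in_itv/= s0 (le_trans st).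
  congr semigroupE; apply/funext => y.
  (* The fixed-point identity [hg] says that [g] is the product of [u] and its [x]-derivative
     [p]. *)
  rewrite derive1_sqr; last by case: (du s y sT).
  by rewrite derive1E; have [_ ->] := du s y sT; rewrite -hg.
- move=> v cv eqv t /cl tT; apply/funext => x.
  have [g' [bg' hg' vE]] := solution_product T01 Xu0 cv eqv.
  have [[B1 hB1] _] := bg'.
  (* Another solution need not stay in the ball of radius [B]; the contraction is invoked again on a
     ball containing both products, with a new rate but the same [T]. *)
  pose B2 := B + `|B1|.
  have B20 : 0 <= B2 by rewrite addr_ge0.
  have [_ [l' l'0 hc']] := hK u0 (derive1 u0) m B2 T bu0 bdu0 hu0 hdu0 T01 B20.
  have hB2 s y : `|g s y| <= B2 by rewrite (le_trans (hgB s y))// lerDl.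
  have hB2' s y : `|g' s y| <= B2.
    by rewrite (le_trans (hB1 s y))// (le_trans (ler_norm _))// lerDr.
  have gg s y : 0 <= s <= T -> g' s y = g s y.
    move=> sT; apply: (@fixed_point_unique R (product_map u0 (derive1 u0) T) B2 T l' g' g
      B20 l'0 _ hB2' hB2 hg' (fun t x _ => hg t x) s y sT).
    by move=> D D0 H; exact: (hc' g' g D bg' bg hB2' hB2 D0 H).
  rewrite (vE t tT) /u clamp_id//.
  apply: (@mild_causal R u0 0 5 g' g t x isT bg' bg (t1 t tT)) => s y /andP[s0 st].
  by apply: gg; rewrite s0 (le_trans st)//; case/andP: tT.
Qed.
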